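(* The following four identities hold: \begin{align*} \sum_{i,j,k,l\geq0}\frac{q^{\frac12\left(i^2+(i-j)^2+(j-k)^2+(k-l)^2\right)+i-j+k-\frac12l}}{(q;q)_i(q;q)_j(q;q)_k(q;q)_l}&=6\frac{J_2^2J_3^3}{J_1^5},\\ \sum_{i,j,k,l\ge 0}\frac{q^{\frac{1}{2}(i^2+(i-j)^2+(j-k)^2+(k-l)^2)+2i-2j+k-\frac{1}{2}l}}{(q;q)_i(q;q)_j(q;q)_k(q;q)_l}&=8q^{-1}\frac{J_2^6}{J_1^6}, \\ \sum_{i,j,k,l\ge 0}\frac{q^{\frac{1}{2}(i^2+(i-j)^2+(j-k)^2+(k-l)^2)+\frac{3}{2}i-\frac{3}{2}j+\frac{1}{2}k}}{(q;q)_i(q;q)_j(q;q)_k(q;q)_l}&=2q^{-\frac{1}{2}}\frac{J_1^3}{J_{\frac{1}{2}}^3}, \\ \sum_{i,j,k,l\ge 0}\frac{q^{\frac{1}{2}(i^2+(i-j)^2+(j-k)^2+(k-l)^2)+i-j+\frac{1}{2}l}}{(q;q)_i(q;q)_j(q;q)_k(q;q)_l}&=4\frac{J_2^6}{J_1^6}. \end{align*}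
   Context: Here $q=e^{2\pi \mathrm{i}\tau}$ with $\mathrm{Im}\,\tau>0$, and $q^r:=e^{2\pi \mathrm{i} r\tau}$ for rational $r$. Notation: $(a;q)_n=\prod_{k=0}^{n-1}(1-aq^k)$, $(a;q)_\infty=\prod_{k\ge0}(1-aq^k)$; $J_m:=(q^m;q^m)_\infty$ for rational $m>0$ (in particular $J_{1/2}=(q^{1/2};q^{1/2})_\infty$). *)

(* Defs.v *)
From HB Require Import structures.
From mathcomp Require Import all_boot all_order all_algebra finmap.
From mathcomp Require Import boolp classical_sets reals topology normedtype.
From mathcomp Require Import sequences exp trigo.
From mathcomp Require Export complex.
From mathcomp.analysis.showcase Require Import summability.

Set Implicit Arguments.
Unset Strict Implicit.
Unset Printing Implicit Defensive.

Import Order.TTheory GRing.Theory Num.Theory.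
Import numFieldNormedType.Exports.

Local Open Scope classical_set_scope.
Local Open Scope ring_scope.
Local Open Scope complex_scope.

Definition cexp (R : realType) (z : R[i]) : R[i] :=
  (expR (complex.Re z))%:C * (cos (complex.Im z) +i* sin (complex.Im z)).

(* q^r = exp(2 pi i r tau).  The power is a function of tau and not of the
   number q, so no branch of the logarithm is involved for fractional r. *)
Definition qpow (R : realType) (tau : R[i]) (r : rat) : R[i] :=
  cexp ((0 +i* (2 * pi)) * ratr r * tau).

Definition nome (R : realType) (tau : R[i]) : R[i] :=
  cexp ((0 +i* (2 * pi)) * tau).

Definition qpoch (R : realType) (a q : R[i]) (n : nat) : R[i] :=
  \prod_(0 <= k < n) (1 - a * q ^+ k).

(* R[i]^o is R[i] with the topology of the complex modulus.  [lim] is total: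
   the value is meaningful only if the product converges, as for `|q| < 1. *)
Definition qpoch_inf (R : realType) (a q : R[i]) : R[i] :=
  lim ((qpoch a q n : R[i]^o) @[n --> \oo]).

Definition J (R : realType) (tau : R[i]) (m : rat) : R[i] :=
  qpoch_inf (qpow tau m) (qpow tau m).

(* Unconditional (equivalently, absolute) convergence of a quadruple series:
   the limit is along the finite subsets of nat^4 directed by inclusion. *)
Definition has_sum4 (R : realType) (f : nat -> nat -> nat -> nat -> R[i])
    (s : R[i]) : Prop :=
  partial_sum (fun n : nat * nat * nat * nat =>
      let: (i, j, k, l) := n in (f i j k l : R[i]^o)) @ totally
    --> (s : R[i]^o).

Definition nahm_summand (R : realType) (tau : R[i])
    (e : rat -> rat -> rat -> rat -> rat) (i j k l : nat) : R[i] :=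
  let q := nome tau in
  qpow tau (e i%:R j%:R k%:R l%:R) /
    (qpoch q q i * qpoch q q j * qpoch q q k * qpoch q q l).

(* Main.v *)
Require Import Defs.
From HB Require Import structures.
From mathcomp Require Import all_boot all_order all_algebra reals.
From mathcomp Require Import finmap boolp classical_sets topology normedtype.
From mathcomp Require Import sequences exp trigo ring lra zify.
From mathcomp.analysis.showcase Require Import summability.

(* Write h = q^(1/2).  The summand of all four series is
   h^(i^2+(i-j)^2+(j-k)^2+(k-l)^2+l+a(i-j)+b(k-l)) / ((q)_i (q)_j (q)_k (q)_l)
   for suitable integers a, b.  The sum over l is an infinite product by Euler.
   The sum over i, j satisfies a first-order recursion in k whose initial value
   is a theta function over (q)_oo by the Durfee rectangle identity, so it is
   a q-binomial sum over k = r + s of shifted theta values.  The exponent then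
   splits in r and s; the s-sum is Lebesgue's identity and a single series in r
   remains.  If b = a - 2, its even and odd parts are summable 1phi1 series of
   base q^2 with equal sums by the Jacobi triple product.  If a = b = 2, expanding
   1/(q)_r = sum_(k+l=r) q^(((l-k)^2+(l-k))/2) / ((q^2;q^2)_k (q^2;q^2)_l)
   and fixing k - l again gives summable 1phi1 series, and what remains is the
   cubic theta series sum q^(m^2+mn+n^2+m+n) = 3 (q^3;q^3)_oo^3 / (q)_oo. *)

Set Implicit Arguments.
Unset Strict Implicit.
Unset Printing Implicit Defensive.

Import Order.TTheory GRing.Theory Num.Theory.
Import numFieldNormedType.Exports.
Import Normc.

Local Open Scope classical_set_scope.
Local Open Scope ring_scope.

(** * Unordered summation *)

Section Summation.
Variable R : realType.
Local Notation C := R[i].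

(** The parameters (a, b) are (2, 2), (4, 2), (3, 1) and (2, 0). A 1phi1 series is summable when its
    upper parameter times its argument matches its lower parameter. Splitting (q)_r by parity
    produces the lower parameters q and q^3, and b = a - 2 is exactly the relation that then holds.
    For a = b = 2 it fails, which forces the detour through an expansion of 1/(q)_r. The cubic
    series becomes a product only after multiplication by the auxiliary series sum h^(N^2 - N): the
    resulting series over Z^3 falls into three copies of a product of three theta series, whence the
    factor 3. Every step interchanges summations, so absolute convergence is carried along. One
    criterion serves throughout: a quadratic exponent that outgrows every linear function beats
    coefficients of at most exponential growth. Theta values with shifted argument grow faster than
    that, so a theta in a summand is first expanded and the larger series is bounded. *)

Lemma normc_ge0 (z : C) : 0 <= normc z.
Proof. by case: z => a b /=; exact: sqrtr_ge0. Qed.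

Lemma normc_sum (I : Type) (s : seq I) (f : I -> C) :
  normc (\sum_(i <- s) f i) <= \sum_(i <- s) normc (f i).
Proof.
elim: s => [|i s IH]; first by rewrite !big_nil normc0.
rewrite !big_cons; apply: le_trans (le_normcD _ _) _; exact: lerD.
Qed.

Lemma normcX (z : C) n : normc (z ^+ n) = normc z ^+ n.
Proof. by elim: n => [|n IH]; rewrite ?expr0 ?normc1 // !exprS normcM IH. Qed.

Lemma normc_le_abs (a b : R) : normc (a +i* b)%C <= `|a| + `|b|.
Proof.
rewrite /normc -[leRHS]ger0_norm ?addr_ge0 // -sqrtr_sqr ler_wsqrtr //.
rewrite sqrrD !real_normK ?num_real //.
have : 0 <= `|a| * `|b| by rewrite mulr_ge0.
by lra.
Qed.

Lemma normRe_le (z : C) : `|complex.Re z| <= normc z.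
Proof.
case: z => a b /=; rewrite -sqrtr_sqr ler_wsqrtr // lerDl; exact: sqr_ge0.
Qed.

Lemma normIm_le (z : C) : `|complex.Im z| <= normc z.
Proof.
case: z => a b /=; rewrite -sqrtr_sqr ler_wsqrtr // lerDr; exact: sqr_ge0.
Qed.

Lemma normc_distC (x y : C) : normc (x - y) = normc (y - x).
Proof. by rewrite -normcN opprB. Qed.

Lemma sum_sub_le (I : eqType) (A B : seq I) (g : I -> R) :
  (forall i, 0 <= g i) -> uniq A -> uniq B -> {subset A <= B} ->
  \sum_(i <- A) g i <= \sum_(i <- B) g i.
Proof.
move=> g0 uA uB sAB; rewrite (bigID (mem A) predT g (r := B)) /=.
have pA : perm_eq [seq i <- B | i \in A] A.
  apply: uniq_perm => //; first exact: filter_uniq.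
  move=> i; rewrite mem_filter andb_idr //; exact: sAB.
have -> : \sum_(i <- A) g i = \sum_(i <- B | i \in A) g i.
  by rewrite -[RHS]big_filter; apply/esym/perm_big.
by rewrite lerDl sumr_ge0.
Qed.

Lemma nonneg_sum_conv (I : eqType) (g : I -> R) (M : R) :
  (forall i, 0 <= g i) ->
  (forall B, uniq B -> \sum_(i <- B) g i <= M) ->
  exists s : R, forall e : R, 0 < e -> exists2 A, uniq A &
    forall B, uniq B -> {subset A <= B} -> `|\sum_(i <- B) g i - s| < e.
Proof.
move=> g0 gM.
pose E := [set x | exists2 B, uniq B & x = \sum_(i <- B) g i]%classic.
have hE : has_sup E.
  split; first by exists (\sum_(i <- [::]) g i); exists [::].
  by exists M => x [B uB ->]; exact: gM.
exists (sup E) => e e0.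
have [x [A uA ->] hA] := sup_adherent e0 hE.
exists A => // B uB AB.
have h1 : \sum_(i <- A) g i <= \sum_(i <- B) g i by exact: sum_sub_le.
have h2 : \sum_(i <- B) g i <= sup E.
  by apply: ub_le_sup; [case: hE | exists B].
rewrite ltr_distlC; apply/andP; split; lra.
Qed.

(* Finite partial sums are indexed by duplicate-free lists rather than by
   finite sets, which makes images and products of index sets painless. *)
Definition has_tsum (I : eqType) (f : I -> C) (s : C) : Prop :=
  forall e : R, 0 < e -> exists2 A, uniq A &
    forall B, uniq B -> {subset A <= B} -> normc (\sum_(i <- B) f i - s) < e.

Definition abs_summable (I : eqType) (f : I -> C) : Prop :=
  exists M : R, forall B, uniq B -> \sum_(i <- B) normc (f i) <= M.

(** Total, with value 0 for a family without a sum; its uses are therefore accompanied by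
    [abs_summable] or [has_tsum]. *)
Definition tsum (I : eqType) (f : I -> C) : C := xget 0 [set s | has_tsum f s]%classic.

Lemma has_tsum_lin (I : eqType) (f g : I -> C) (c s t : C) :
  has_tsum f s -> has_tsum g t -> has_tsum (fun i => c * f i + g i) (c * s + t).
Proof.
move=> hf hg e e0.
have c0 : 0 < normc c + 1 by have := normc_ge0 c; lra.
have [A uA hA] := hf (e / 2 / (normc c + 1)) ltac:(by rewrite !divr_gt0).
have [A' uA' hA'] := hg (e / 2) ltac:(by rewrite divr_gt0).
exists (undup (A ++ A')); first exact: undup_uniq.
move=> B uB sB; rewrite big_split /= -mulr_sumr.
have h1 := hA B uB (fun x hx => sB x ltac:(by rewrite mem_undup mem_cat hx)).
have h2 := hA' B uB (fun x hx => sB x ltac:(by rewrite mem_undup mem_cat hx orbT)).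
have -> : c * \sum_(i <- B) f i + \sum_(i <- B) g i - (c * s + t) =
  c * (\sum_(i <- B) f i - s) + (\sum_(i <- B) g i - t) by ring.
apply: le_lt_trans (le_normcD _ _) _; rewrite normcM.
have h3 : normc c * normc (\sum_(i <- B) f i - s) <= e / 2.
  apply: le_trans (_ : (normc c + 1) * (e / 2 / (normc c + 1)) <= _).
    apply: ler_pM => //; rewrite ?normc_ge0 ?lerDl //; exact: ltW.
  by rewrite mulrC divfK // gt_eqF.
lra.
Qed.

Lemma has_tsum_ext (I : eqType) (f g : I -> C) s : f =1 g -> has_tsum f s -> has_tsum g s.
Proof. by move=> /funext ->. Qed.

Lemma has_tsum_0 (I : eqType) : has_tsum (fun _ : I => 0) 0.
Proof.
by move=> e e0; exists [::] => // B _ _; rewrite big1 // subrr normc0.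
Qed.

Lemma has_tsum_scale (I : eqType) (f : I -> C) c s :
  has_tsum f s -> has_tsum (fun i => c * f i) (c * s).
Proof.
move=> hf; rewrite -[c * s]addr0; have := has_tsum_lin c hf (@has_tsum_0 I).
by apply: has_tsum_ext => i; rewrite addr0.
Qed.

Lemma has_tsum_sub (I : eqType) (f g : I -> C) s t :
  has_tsum f s -> has_tsum g t -> has_tsum (fun i => f i - g i) (s - t).
Proof.
move=> hf hg; rewrite -[- t]mulN1r addrC; have := has_tsum_lin (-1) hg hf.
by apply: has_tsum_ext => i; rewrite mulN1r addrC.
Qed.

Lemma has_tsum_le (I : eqType) (f : I -> C) (s : C) (M : R) :
  (forall B, uniq B -> \sum_(i <- B) normc (f i) <= M) -> has_tsum f s -> normc s <= M.
Proof.
move=> fM hs; apply/ler_addgt0Pr => e e0.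
have [A uA /(_ A uA (fun _ h => h))] := hs e e0.
rewrite normc_distC => h.
rewrite -[s](subrK (\sum_(i <- A) f i)).
apply: le_trans (le_normcD _ _) _.
have := le_trans (normc_sum A f) (fM A uA); lra.
Qed.

Lemma has_tsum_unique (I : eqType) (f : I -> C) s t : has_tsum f s -> has_tsum f t -> s = t.
Proof.
move=> hs ht; apply/eqP; rewrite -subr_eq0; apply/eqP/eq0_normc/eqP.
rewrite eq_le normc_ge0 andbT.
apply: (has_tsum_le (f := fun i : I => f i - f i)); last exact: has_tsum_sub.
by move=> B _; rewrite big1 // => i _; rewrite subrr normc0.
Qed.

Lemma tsumE (I : eqType) (f : I -> C) s : has_tsum f s -> tsum f = s.
Proof. by move=> hs; apply: (has_tsum_unique _ hs); exact: (xgetPex 0 (ex_intro _ s hs)). Qed.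

Lemma abs_summable_le (I : eqType) (f g : I -> C) :
  (forall i, normc (f i) <= normc (g i)) -> abs_summable g -> abs_summable f.
Proof.
move=> fg [M gM]; exists M => B uB; apply: le_trans (gM B uB).
by apply: ler_sum => i _.
Qed.

(** Adding the modulus makes the real and imaginary parts nonnegative, so their finite sums converge
    to a supremum; the sum of the moduli is then subtracted. *)
Lemma abs_summable_has_tsum (I : eqType) (f : I -> C) : abs_summable f -> has_tsum f (tsum f).
Proof.
move=> [M fM].
suff [s hs] : exists s, has_tsum f s by rewrite (tsumE hs).
pose n i := normc (f i).
have n0 i : 0 <= n i by exact: normc_ge0.
have hn : forall u : I -> R, (forall i, `|u i| <= n i) ->
  exists s : R, forall e : R, 0 < e -> exists2 A, uniq A &
    forall B, uniq B -> {subset A <= B} -> `|\sum_(i <- B) (u i + n i) - s| < e.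
  move=> u hu; apply: (@nonneg_sum_conv _ _ (M + M)) => [i|B uB].
    by have := hu i; rewrite ler_norml; lra.
  rewrite big_split lerD ?fM //=; apply: le_trans (fM B uB).
  by apply: ler_sum => i _; apply: le_trans (ler_norm _) (hu i).
have [s1 h1] := hn (fun i => complex.Re (f i)) (fun i => normRe_le _).
have [s3 h3] := hn (fun i => complex.Im (f i)) (fun i => normIm_le _).
have [s2 h2] := nonneg_sum_conv n0 fM.
exists ((s1 - s2) +i* (s3 - s2))%C => e e0.
have e4 : 0 < e / 4 by rewrite divr_gt0.
have [A1 u1 hA1] := h1 _ e4; have [A2 u2 hA2] := h2 _ e4.
have [A3 u3 hA3] := h3 _ e4.
exists (undup (A1 ++ A2 ++ A3)); first exact: undup_uniq.
move=> B uB sB.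
have {}hA1 := hA1 B uB (fun x hx => sB x ltac:(by rewrite mem_undup !mem_cat hx)).
have {}hA2 := hA2 B uB (fun x hx => sB x ltac:(by rewrite mem_undup !mem_cat hx orbT)).
have {}hA3 := hA3 B uB (fun x hx => sB x ltac:(by rewrite mem_undup !mem_cat hx !orbT)).
move: hA1 hA2 hA3; rewrite !big_split /=.
have -> : \sum_(i <- B) f i = ((\sum_(i <- B) complex.Re (f i)) +i*
                              (\sum_(i <- B) complex.Im (f i)))%C.
  elim: B {uB sB} => [|i B IH]; first by rewrite !big_nil.
  by rewrite !big_cons IH; case: (f i).
move: (\sum_(i <- B) _) (\sum_(i <- B) _) (\sum_(i <- B) _) => a b c.
rewrite !ltr_distlC => /andP[? ?] /andP[? ?] /andP[? ?].
apply: le_lt_trans (normc_le_abs _ _) _.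
have -> : e = e / 2 + e / 2 by lra.
by apply: ltrD; rewrite ltr_norml; apply/andP; split; lra.
Qed.

Lemma tsum_ext (I : eqType) (f g : I -> C) : f =1 g -> tsum f = tsum g.
Proof. by move=> /funext ->. Qed.

Lemma abs_summable_ext (I : eqType) (f g : I -> C) : f =1 g -> abs_summable f -> abs_summable g.
Proof. by move=> /funext ->. Qed.

Lemma tsum_le (I : eqType) (f : I -> C) (M : R) :
  (forall B, uniq B -> \sum_(i <- B) normc (f i) <= M) -> normc (tsum f) <= M.
Proof. by move=> h; apply: (has_tsum_le h); apply: abs_summable_has_tsum; exists M. Qed.

Lemma abs_summable_scale (I : eqType) (f : I -> C) c : abs_summable f -> abs_summable (fun i =>
    c * f i).
Proof.
move=> [M h]; exists (normc c * M) => B uB.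
under eq_bigr => i _ do rewrite normcM.
by rewrite -mulr_sumr ler_wpM2l ?normc_ge0 ?h.
Qed.

Lemma tsum_scale (I : eqType) (f : I -> C) c :
  abs_summable f -> tsum (fun i => c * f i) = c * tsum f.
Proof. by move=> /abs_summable_has_tsum /(has_tsum_scale c)/tsumE. Qed.

Lemma abs_summable_add (I : eqType) (f g : I -> C) :
  abs_summable f -> abs_summable g -> abs_summable (fun i => f i + g i).
Proof.
move=> [M h] [M' h']; exists (M + M') => B uB.
apply: le_trans (lerD (h B uB) (h' B uB)); rewrite -big_split /=.
by apply: ler_sum => i _; exact: le_normcD.
Qed.

Lemma tsum_sub (I : eqType) (f g : I -> C) :
  abs_summable f -> abs_summable g -> tsum (fun i => f i - g i) = tsum f - tsum g.
Proof. by move=> /abs_summable_has_tsum hf /abs_summable_has_tsum hg; apply: tsumE; exact: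
    has_tsum_sub. Qed.

Section Injection.
Variables (I J : eqType) (h : J -> I) (f : I -> C).
Hypothesis injh : injective h.
Hypothesis f0 : forall i, (forall j, h j != i) -> f i = 0.

(** Stated for every [g] that vanishes where [f] does, so that it serves both [f] and its
    modulus. *)
Let preim (B : seq I) : uniq B ->
  exists B' : seq J, [/\ uniq B', (forall j, (j \in B') = (h j \in B)) &
    forall (V : zmodType) (g : I -> V), (forall i, f i = 0 -> g i = 0) ->
      \sum_(i <- B) g i = \sum_(j <- B') g (h j)].
Proof.
elim: B => [|i B IH] /=.
  move=> _; exists [::]; split=> //.
  by move=> V g _; rewrite !big_nil.
move=> /andP[iB /IH[B' [uB' mB' sB']]].
have [[j hj]|hi] := pselect (exists j, h j = i).
  exists (j :: B'); split => /=.
  - by rewrite uB' mB' hj iB.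
  - by move=> j'; rewrite !inE mB' -hj (inj_eq injh).
  - by move=> V g g0; rewrite !big_cons sB' // hj.
have hi' j : (h j == i) = false by apply/eqP => hj; apply: hi; exists j.
exists B'; split=> //.
- by move=> j; rewrite inE hi' mB'.
- move=> V g g0; rewrite big_cons sB' // g0 ?add0r //; apply: f0 => j.
  by rewrite hi'.
Qed.

Lemma abs_summable_inj : abs_summable (f \o h) <-> abs_summable f.
Proof.
split=> -[M hM]; exists M => B uB.
  have [B' [uB' _ ->]] := preim uB; first exact: hM.
  by move=> i ->; rewrite normc0.
by have := hM (map h B); rewrite big_map; apply; rewrite map_inj_uniq.
Qed.

Lemma has_tsum_inj s : has_tsum (f \o h) s -> has_tsum f s.
Proof.
move=> hs e e0; have [A uA hA] := hs e e0.
exists (map h A); first by rewrite map_inj_uniq.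
move=> B uB AB; have [B' [uB' mB' ->]] // := preim uB.
by apply: hA => // j jA; rewrite mB' AB // map_f.
Qed.

Lemma tsum_inj : abs_summable f -> tsum f = tsum (f \o h).
Proof. by move=> /abs_summable_inj/abs_summable_has_tsum/has_tsum_inj/tsumE. Qed.

End Injection.

Lemma tsum_bij (I J : eqType) (h : J -> I) (f : I -> C) :
  bijective h -> abs_summable f -> tsum f = tsum (fun j => f (h j)).
Proof.
move=> bh; apply: tsum_inj; first exact: bij_inj.
by case: bh => g _ gK i /(_ (g i)); rewrite gK eqxx.
Qed.

Lemma abs_summable_bij (I J : eqType) (h : J -> I) (f : I -> C) :
  bijective h -> abs_summable (fun j => f (h j)) <-> abs_summable f.
Proof.
move=> bh; apply: abs_summable_inj; first exact: bij_inj.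
by case: bh => g _ gK i /(_ (g i)); rewrite gK eqxx.
Qed.

Lemma abs_summable_comp (I J : eqType) (h : J -> I) (f : I -> C) :
  injective h -> abs_summable f -> abs_summable (fun j => f (h j)).
Proof.
move=> ih [M hM]; exists M => B uB.
by have := hM (map h B); rewrite big_map; apply; rewrite map_inj_uniq.
Qed.

Lemma tsum_fin (I : finType) (f : I -> C) : has_tsum f (\sum_i f i) /\ abs_summable f.
Proof.
split.
  move=> e e0; exists (index_enum I); first exact: index_enum_uniq.
  move=> B uB sB; rewrite (perm_big (index_enum I)) ?subrr ?normc0 //.
  apply: uniq_perm => //; first exact: index_enum_uniq.
  by move=> i; rewrite mem_index_enum; apply: sB; rewrite mem_index_enum.
exists (\sum_i normc (f i)) => B uB.
apply: sum_sub_le => //; rewrite ?index_enum_uniq // => i;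
  by rewrite ?normc_ge0 ?mem_index_enum.
Qed.

Section Fubini.
Variables (I J : eqType) (f : I * J -> C).
Hypothesis fS : abs_summable f.

Lemma abs_summable_section i : abs_summable (fun j => f (i, j)).
Proof. by apply: (abs_summable_comp (h := fun j => (i, j))) => // a b []. Qed.

(** One finite set of columns approximates all the rows in [B] at once. *)
Let approx (B : seq I) (A : seq J) (e : R) : 0 < e ->
  exists K, [/\ uniq K, {subset A <= K} & forall i, i \in B ->
    normc (\sum_(j <- K) f (i, j) - tsum (fun j => f (i, j))) < e].
Proof.
move=> e0; suff [D hD] : exists D : seq J, forall K : seq J, uniq K -> {subset D <= K} ->
  forall i, i \in B -> normc (\sum_(j <- K) f (i, j) - tsum (fun j => f (i, j))) < e.
  exists (undup (A ++ D)); split; first exact: undup_uniq.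
    by move=> x xA; rewrite mem_undup mem_cat xA.
  apply: hD; first exact: undup_uniq.
  by move=> x xA; rewrite mem_undup mem_cat xA orbT.
elim: B => [|i B [D hD]]; first by exists [::].
have [D' _ hD'] := abs_summable_has_tsum (abs_summable_section i) e0.
exists (D ++ D') => K uK sK i'; rewrite inE => /orP[/eqP ->|].
  by apply: hD' => // x xD; rewrite sK // mem_cat xD orbT.
by apply: hD => // x xD; rewrite sK // mem_cat xD.
Qed.

Let sum_prod (V : zmodType) (g : I * J -> V) (A : seq I) (B : seq J) :
  \sum_(i <- A) \sum_(j <- B) g (i, j) =
  \sum_(p <- [seq (i, j) | i <- A, j <- B]) g p.
Proof. by rewrite big_allpairs. Qed.

Let small (B : seq I) (e : R) : 0 < e -> exists2 d : R, 0 < d & d * (size B)%:R <= e.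
Proof.
move=> e0; exists (e / (size B).+1%:R); first by rewrite divr_gt0.
by rewrite mulrAC ler_pdivrMr // ler_wpM2l ?(ltW e0) // ler_nat.
Qed.

Lemma abs_summable_outer : abs_summable (fun i => tsum (fun j => f (i, j))).
Proof.
case: (fS) => M hM; exists M => B uB; apply/ler_addgt0Pr => e e0.
have [d d0 hd] := small B e0.
have [D [uD _ hD]] := approx B [::] d0.
have h : \sum_(i <- B) normc (tsum (fun j => f (i, j))) <=
  \sum_(i <- B) (\sum_(j <- D) normc (f (i, j)) + d).
  rewrite big_seq_cond [leRHS]big_seq_cond; apply: ler_sum => i /andP[iB _].
  have := hD i iB; rewrite normc_distC => h.
  rewrite -[tsum _](subrK (\sum_(j <- D) f (i, j))).
  apply: le_trans (le_normcD _ _) _; rewrite addrC lerD //; last exact: ltW.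
  exact: normc_sum.
apply: le_trans h _; rewrite big_split /= lerD //.
  by rewrite (sum_prod (fun p => normc (f p))) hM // allpairs_uniq // => -[? ?] [? ?] _ _ [-> ->].
by rewrite big_const_seq count_predT iter_addr_0 -mulr_natr.
Qed.

(** [B] contains the first coordinates of a set [A] that is good for the double series, and [D] its
    second coordinates. The rectangle then contains [A], and the row tails beyond [D] add up to at
    most e/4. *)
Lemma fubini : tsum f = tsum (fun i => tsum (fun j => f (i, j))).
Proof.
apply/esym/tsumE => e e0.
have e2 : 0 < e / 2 by rewrite divr_gt0.
have [A uA hA] := abs_summable_has_tsum fS e2.
exists (undup (map fst A)); first exact: undup_uniq.
move=> B uB sB.
have e4 : 0 < e / 4 by rewrite divr_gt0.
have [d d0 hd] := small B e4.
have [D [uD sD hD]] := approx B (map snd A) d0.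
have := hA [seq (i, j) | i <- B, j <- D].
rewrite -sum_prod => {}hA.
have {hA}hA : normc (\sum_(i <- B) \sum_(j <- D) f (i, j) - tsum f) < e / 2.
  apply: hA; first by rewrite allpairs_uniq // => -[? ?] [? ?] _ _ [-> ->].
  move=> [i j] ij; apply: allpairs_f.
    by apply: sB; rewrite mem_undup; apply/mapP; exists (i, j).
  by apply: sD; apply/mapP; exists (i, j).
have h : normc (\sum_(i <- B) (tsum (fun j => f (i, j)) - \sum_(j <- D) f (i, j)))
  <= e / 4.
  apply: le_trans (normc_sum _ _) _; apply: le_trans hd.
  have <- : \sum_(i <- B) d = d * (size B)%:R.
    by rewrite big_const_seq count_predT iter_addr_0 mulr_natr.
  rewrite big_seq_cond [leRHS]big_seq_cond; apply: ler_sum => i /andP[iB _].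
  by rewrite normc_distC ltW // hD.
rewrite sumrB in h.
rewrite -[X in normc X](subrKA (\sum_(i <- B) \sum_(j <- D) f (i, j))).
apply: le_lt_trans (le_normcD _ _) _; lra.
Qed.

End Fubini.

Lemma abs_summable_mul (I J : eqType) (f : I -> C) (g : J -> C) :
  abs_summable f -> abs_summable g -> abs_summable (fun p => f p.1 * g p.2).
Proof.
move=> [M hM] [N hN]; exists (M * N) => B uB.
pose A1 := undup (map fst B); pose A2 := undup (map snd B).
apply: (@le_trans _ _
  (\sum_(p <- [seq (i, j) | i <- A1, j <- A2]) normc (f p.1 * g p.2))).
  apply: sum_sub_le => //.
  - by move=> p; exact: normc_ge0.
  - by rewrite allpairs_uniq ?undup_uniq // => -[? ?] [? ?] _ _ [-> ->].
  - move=> [i j] ij; apply: allpairs_f; rewrite mem_undup;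
    by apply/mapP; exists (i, j).
rewrite big_allpairs /=.
under eq_bigr => i _ do (under eq_bigr => j _ do rewrite normcM; rewrite -mulr_sumr).
rewrite -mulr_suml ler_pM ?hM ?hN ?undup_uniq //;
  by apply: sumr_ge0 => i _; exact: normc_ge0.
Qed.

Lemma tsum_mul (I J : eqType) (f : I -> C) (g : J -> C) :
  abs_summable f -> abs_summable g -> tsum (fun p : I * J => f p.1 * g p.2) = tsum f * tsum g.
Proof.
move=> hf hg; rewrite (fubini (abs_summable_mul hf hg)) /=.
rewrite (tsum_ext (g := fun i => tsum g * f i)) => [|i].
  by rewrite tsum_scale // mulrC.
by rewrite tsum_scale // mulrC.
Qed.

End Summation.

(** * Exponential bounds and quadratic exponents *)

Section Estimates.
Variable R : realType.
Local Notation C := R[i].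

Lemma expr_small (r e : R) : 0 <= r < 1 -> 0 < e -> exists N, forall n, (N <= n)%N -> r ^+ n < e.
Proof.
move=> /andP[r0 r1] e0.
have /cvgrPdist_lt /(_ e e0) : (GRing.exp r : R^nat) @ \oo --> (0 : R).
  by apply: cvg_expr; rewrite ger0_norm.
case=> N _ hN; exists N => n Nn; have := hN n Nn.
by rewrite /= sub0r normrN ger0_norm // exprn_ge0.
Qed.

Lemma lim_normc (u : nat -> C) (l : C) :
  (forall e : R, 0 < e -> exists N, forall n, (N <= n)%N -> normc (u n - l) < e) ->
  lim ((u n : C^o) @[n --> \oo]%classic) = l.
Proof.
move=> h; apply: (@cvg_lim C^o); first exact: norm_hausdorff.
(* A positive element of [R[i]] has imaginary part 0, so the tolerance is a real number. *)
apply/cvgrPdist_lt => -[e e'] /=; rewrite ltcE /= => /andP[/eqP -> e0].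
have [N hN] := h _ e0; exists N => // n Nn /=.
rewrite distrC; have -> : `|(u n : C^o) - l| = (normc (u n - l))%:C%C by [].
by rewrite ltcR hN.
Qed.

(** The growth allowed for the coefficients of a series: exponential in a size function [s]. The
    class is closed under products, and a quadratic exponent absorbs it. *)
Definition exp_bounded (I : Type) (s : I -> nat) (g : I -> C) : Prop :=
  exists K B : R, [/\ 0 <= K, 1 <= B & forall x, normc (g x) <= K * B ^+ s x].

Lemma exp_boundedM (I : Type) s (f g : I -> C) :
  exp_bounded s f -> exp_bounded s g -> exp_bounded s (fun x => f x * g x).
Proof.
move=> [K [B [K0 B1 h]]] [K' [B' [K0' B1' h']]]; exists (K * K'), (B * B'); split.
- exact: mulr_ge0.
- by rewrite mulr_ege1.
- move=> x; rewrite normcM exprMn mulrACA ler_pM ?normc_ge0 //.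
Qed.

Lemma exp_bounded_const (I : Type) (s : I -> nat) (c : C) : exp_bounded s (fun=> c).
Proof.
exists (normc c), 1; split; rewrite ?normc_ge0 // => x.
by rewrite expr1n mulr1.
Qed.

Lemma exp_bounded_comp (I J : Type) (s : I -> nat) (t : J -> nat) (phi : J -> I) g :
  (forall x, (s (phi x) <= t x)%N) -> exp_bounded s g -> exp_bounded t (fun x => g (phi x)).
Proof.
move=> st [K [B [K0 B1 h]]]; exists K, B; split=> // x.
apply: le_trans (h _) _; rewrite ler_wpM2l // ler_weXn2l //.
Qed.

Lemma exp_bounded_nat (I : Type) (s : I -> nat) (phi : I -> nat) (g : nat -> C) :
  (forall x, (phi x <= s x)%N) -> exp_bounded id g -> exp_bounded s (fun x => g (phi x)).
Proof. exact: exp_bounded_comp. Qed.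

Lemma exp_bounded_prod (g : nat -> C) (B : R) :
  (forall n, normc (g n) <= B) -> exp_bounded id (fun n => \prod_(0 <= k < n) g k).
Proof.
move=> h; exists 1, (B + 1).
have B0 : 0 <= B by apply: le_trans (h 0%N); exact: normc_ge0.
split=> //; first by rewrite lerDr.
elim=> [|n IH]; first by rewrite big_nil normc1 expr0 mulr1.
rewrite big_nat_recr //= normcM exprSr mulrA ler_pM ?normc_ge0 //.
by apply: le_trans (h n) _; rewrite lerDl.
Qed.

Lemma exp_bounded_exp (z : C) : exp_bounded id (fun n => z ^+ n).
Proof.
exists 1, (1 + normc z); split=> //; first by rewrite lerDl normc_ge0.
move=> n; rewrite mul1r normcX lerXn2r ?nnegrE ?normc_ge0 //.
  by rewrite addr_ge0 ?normc_ge0.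
by rewrite lerDr.
Qed.

Lemma exp_bounded_qpoch (a q : C) : normc q <= 1 -> exp_bounded id (qpoch a q).
Proof.
move=> q1; apply: (@exp_bounded_prod _ (1 + normc a)) => n.
apply: le_trans (le_normcD _ _) _; rewrite normc1 lerD2l normcN normcM normcX.
by rewrite ler_piMr ?normc_ge0 // exprn_ile1 ?normc_ge0.
Qed.

Lemma normc_1sub (z : C) : 1 - normc z <= normc (1 - z).
Proof.
have := le_normcD (1 - z) z; rewrite subrK normc1; lra.
Qed.

Lemma exp_bounded_qpochV (a q : C) : normc a < 1 -> normc q <= 1 ->
  exp_bounded id (fun n => (qpoch a q n)^-1).
Proof.
move=> a1 q1.
have -> : (fun n => (qpoch a q n)^-1) =
   (fun n => \prod_(0 <= k < n) (1 - a * q ^+ k)^-1).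
  by apply/funext => n; rewrite /qpoch -prodfV.
apply: (@exp_bounded_prod _ (1 - normc a)^-1) => n; rewrite normcV.
have h : normc (a * q ^+ n) <= normc a.
  by rewrite normcM normcX ler_piMr ?normc_ge0 // exprn_ile1 ?normc_ge0.
have := normc_1sub (a * q ^+ n) => h'.
have a0 : 0 < 1 - normc a by rewrite subr_gt0.
have h2 : 1 - normc a <= normc (1 - a * q ^+ n).
  by apply: le_trans h'; rewrite lerD2l lerN2.
by rewrite lef_pV2 ?posrE // (lt_le_trans a0).
Qed.

Section Quad.
Variable h : C.
Hypothesis h0 : h != 0.
Hypothesis h1 : normc h < 1 :> R.

Lemma normc_gt0 (z : C) : z != 0 -> 0 < normc z.
Proof.
by move=> z0; rewrite lt_def normc_ge0 andbT; apply: contra z0 => /eqP/eq0_normc ->.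
Qed.

Definition size_summable (I : eqType) (s : I -> nat) := abs_summable (fun x => h ^+ s x).

Lemma size_summable_nat : size_summable (@id nat).
Proof.
exists (1 - normc h)^-1 => B uB.
have B1 : 0 < 1 - normc h by rewrite subr_gt0.
pose n := (\max_(i <- B) i).+1.
apply: le_trans (_ : \sum_(i <- iota 0 n) normc h ^+ i <= _).
  under eq_bigr => i _ do rewrite normcX.
  apply: sum_sub_le; rewrite ?iota_uniq // => i.
    by rewrite exprn_ge0 ?normc_ge0.
  by move=> iB; rewrite mem_iota /= add0n ltnS (@leq_bigmax_seq _ B predT id).
have -> : iota 0 n = index_iota 0 n by rewrite /index_iota subn0.
rewrite big_mkord -(ler_pM2l B1) divff ?gt_eqF //.
rewrite -[1 - normc h]opprB mulNr -subrX1 opprB lerBlDr lerDl.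
by rewrite exprn_ge0 ?normc_ge0.
Qed.

Lemma size_summable_mul (I J : eqType) (s : I -> nat) (t : J -> nat) :
  size_summable s -> size_summable t -> size_summable (fun p => s p.1 + t p.2)%N.
Proof.
move=> hs ht; apply: abs_summable_ext (abs_summable_mul hs ht) => p /=; by rewrite exprD.
Qed.

Lemma size_summable_int : size_summable absz.
Proof.
have h2 := abs_summable_mul (tsum_fin (fun _ : bool => (1 : C))).2 size_summable_nat.
apply: abs_summable_ext (abs_summable_comp (h := fun m : int => (m < 0, absz m)) _ h2) => [m|m
    n [E1 E2]].
  by rewrite mul1r.
by move: E1 E2; clear; lia.
Qed.

Lemma ler_exprz_anti (r : R) (m n : int) : 0 < r -> r <= 1 -> n <= m -> r ^ m <= r ^ n.
Proof.
move=> r0 r1 nm; rewrite -(opprK m) -(opprK n) -!(exprz_inv r).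
by rewrite ler_weXz2l ?invf_ge1 ?lerN2.
Qed.

Lemma normcXz (z : C) (n : int) : normc (z ^ n) = normc z ^ n.
Proof. by case: n => n; rewrite ?NegzE -?exprnP -?exprnN ?normcV normcX. Qed.

(** Choose A with |h|^A B <= |h|. The exponent exceeds A times the size up to a constant, so the
    growth B^s is absorbed and the summable family |h|^s remains as a majorant. *)
Lemma abs_summable_quad (I : eqType) (s : I -> nat) (E : I -> int) (g : I -> C) :
  size_summable s -> exp_bounded s g ->
  (forall A : nat, exists K : int, forall x, (A * s x)%:Z <= E x + K) ->
  abs_summable (fun x => h ^ E x * g x).
Proof.
move=> hs [K [B [K0 B1 hB]]] hE.
set r := normc h; have r0 : 0 < r by exact: normc_gt0.
have [A hA] : exists A, r ^+ A * B <= r.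
  have [N hN] := @expr_small r (r / B) ltac:(by rewrite ltW) ltac:(by rewrite divr_gt0 //
      (lt_le_trans ltr01)).
  by exists N; rewrite -ler_pdivlMr ?(lt_le_trans ltr01) // ltW // hN.
have [M hM] : exists M : nat, forall x, (A * s x)%:Z <= E x + M%:Z.
  by have [K' hK] := hE A; exists `|K'|%N => x; have := hK x; lia.
have B0 : 0 <= B by rewrite (le_trans ler01).
apply: abs_summable_le (abs_summable_scale ((K * r ^- M)%:C)%C hs) => x.
rewrite !normcM normcXz normcX /= expr0n addr0 sqrtr_sqr ger0_norm; last first.
  by rewrite mulr_ge0 // invr_ge0 exprn_ge0 // ltW.
rewrite -/r -[X in _ <= X]mulrA [leRHS]mulrCA.
apply: le_trans (_ : r ^ (A * s x)%:Z * r ^- M * (K * B ^+ s x) <= _).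
  rewrite ler_pM ?normc_ge0 ?exprz_ge0 ?(ltW r0) // exprnN -expfzDr ?gt_eqF //.
  apply: ler_exprz_anti => //; first exact: ltW.
  by have := hM x; lia.
have -> : r ^ (A * s x)%:Z / r ^+ M * (K * B ^+ s x) =
  r ^- M * (K * (r ^+ A * B) ^+ s x).
  by rewrite -exprnP exprM exprMn; ring.
rewrite !ler_wpM2l ?invr_ge0 ?exprn_ge0 ?(ltW r0) //.
by rewrite lerXn2r ?nnegrE ?(ltW r0) // mulr_ge0 ?exprn_ge0 ?(ltW r0).
Qed.

End Quad.
End Estimates.

(** * Pochhammer symbols and the theorem of Euler *)

Section Pochhammer.
Variable R : realType.
Local Notation C := R[i].
Implicit Types (a q x y : C).

Lemma qpoch0 a q : qpoch a q 0 = 1.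
Proof. by rewrite /qpoch big_nil. Qed.

Lemma qpochSr a q n : qpoch a q n.+1 = qpoch a q n * (1 - a * q ^+ n).
Proof. by rewrite /qpoch big_nat_recr. Qed.

Lemma qpochSl a q n : qpoch a q n.+1 = (1 - a) * qpoch (a * q) q n.
Proof.
rewrite /qpoch big_nat_recl //= expr0 mulr1; congr (_ * _).
by apply: eq_bigr => k _; rewrite exprS mulrA.
Qed.

Lemma qpochD a q m n : qpoch a q (m + n) = qpoch a q m * qpoch (a * q ^+ m) q n.
Proof.
elim: n => [|n IH]; first by rewrite addn0 qpoch0 mulr1.
by rewrite addnS !qpochSr IH -mulrA -[in RHS](mulrA a) exprD mulrA.
Qed.

Lemma qpoch_double a q n :
  qpoch a q n.*2 = qpoch a (q ^+ 2) n * qpoch (a * q) (q ^+ 2) n.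
Proof.
elim: n => [|n IH]; first by rewrite !qpoch0 mulr1.
rewrite doubleS !qpochSr IH -mul2n (exprS _ (2 * n)%N) exprM; move: ((q ^+ 2) ^+ n) => Q; ring.
Qed.

Lemma qpoch_sqr a q n :
  qpoch a q n * qpoch (- a) q n = qpoch (a ^+ 2) (q ^+ 2) n.
Proof.
elim: n => [|n IH]; first by rewrite !qpoch0 mulr1.
rewrite !qpochSr -IH -exprM mulnC exprM; move: (q ^+ n) => Q; ring.
Qed.

Lemma qpoch_neq0 a q n : normc a < 1 -> normc q <= 1 -> qpoch a q n != 0.
Proof.
move=> a1 q1; rewrite /qpoch prodf_seq_neq0; apply/allP => k _ /=.
apply/negP => /eqP/(congr1 (@normc _)); rewrite normc0 => h0.
have := normc_1sub (a * q ^+ k); rewrite h0 subr_le0 normcM normcX leNgt.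
apply/negP; rewrite negbK; apply: le_lt_trans a1.
by rewrite ler_piMr ?normc_ge0 // exprn_ile1 ?normc_ge0.
Qed.

Lemma qpoch1 q n : qpoch 1 q n.+1 = 0.
Proof. by rewrite qpochSl subrr mul0r. Qed.

(** The superlinear growth that [abs_summable_quad] asks of the exponent C(n, 2). *)
Lemma bin2_ge (A n : nat) : (A * n <= 'C(n, 2) + A * A.+1)%N.
Proof.
have : ('C(n, 2) * 2 + n = n * n)%N.
  by elim: n => [|n IH] //; rewrite binS bin1; nia.
nia.
Qed.

Lemma bin2D (t u : nat) : 'C(t + u, 2) = ('C(t, 2) + 'C(u, 2) + t * u)%N.
Proof.
elim: u => [|u IH]; first by rewrite addn0 bin0n muln0 !addn0.
by rewrite addnS !binS !bin1 IH; lia.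
Qed.

Lemma bin2_sqr n : ('C(n, 2).*2 + n = n * n)%N.
Proof. by elim: n => [|n IH] //; rewrite binS bin1; nia. Qed.

Section Regroup.

Lemma tsum_ord (n : nat) (f : nat -> C) : (forall t, (n <= t)%N -> f t = 0) ->
  tsum f = \sum_(t < n) f t.
Proof.
move=> hf; rewrite -(tsumE (tsum_fin (fun t : 'I_n => f t)).1).
apply: (tsum_inj (h := @nat_of_ord n)) => [||]; first exact: ord_inj.
  move=> t ht; apply: hf; rewrite leqNgt; apply/negP => tn.
  by have := ht (Ordinal tn); rewrite eqxx.
apply/(abs_summable_inj (h := @nat_of_ord n)) => [||]; first exact: ord_inj.
  move=> t ht; apply: hf; rewrite leqNgt; apply/negP => tn.
  by have := ht (Ordinal tn); rewrite eqxx.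
exact: (tsum_fin _).2.
Qed.

(** Summation along antidiagonals: [f] is transported to the triangle t <= n, extended by 0, and
    Fubini is applied there. *)
Lemma tsum_regroup (f : nat * nat -> C) : abs_summable f ->
  tsum f = tsum (fun n => \sum_(t < n.+1) f (val t, n - t)%N) /\
  abs_summable (fun n => \sum_(t < n.+1) f (val t, n - t)%N).
Proof.
move=> sf.
pose F (p : nat * nat) := if (p.2 <= p.1)%N then f (p.2, p.1 - p.2)%N else 0.
pose h (p : nat * nat) := (p.1 + p.2, p.1)%N.
have ih : injective h by move=> [a b] [c d] [] /= E1 E2; congr pair; lia.
have Fh : F \o h =1 f.
  by move=> [a b]; rewrite /F /h /= leq_addr addKn.
have F0 : forall i, (forall j, h j != i) -> F i = 0.
  move=> [n t] H; rewrite /F /=; case: leqP => // tn.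
  by have := H (t, n - t)%N; rewrite /h /= subnKC // eqxx.
have sF : abs_summable F by apply/(abs_summable_inj ih F0); apply: abs_summable_ext sf => p;
    rewrite Fh.
have E n : tsum (fun t => F (n, t)) = \sum_(t < n.+1) f (val t, n - t)%N.
  rewrite (@tsum_ord n.+1) => [|t tn]; last by rewrite /F /= leqNgt tn.
  by apply: eq_bigr => t _; rewrite /F /= -ltnS ltn_ord.
split; last by apply: abs_summable_ext (abs_summable_outer sF) => n; rewrite E.
rewrite -(tsum_ext Fh) -(tsum_inj ih F0 sF) fubini //.
by apply: tsum_ext => n; rewrite E.
Qed.

End Regroup.

Section Base.
Variable q : C.
Hypothesis q0 : q != 0.
Hypothesis q1 : normc q < 1.

Let q1' : normc q <= 1. Proof. exact: ltW. Qed.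

Lemma qq_neq0 n : qpoch q q n != 0.
Proof. exact: qpoch_neq0. Qed.

Lemma exp_bounded_qq : exp_bounded id (fun n => (qpoch q q n)^-1).
Proof. exact: exp_bounded_qpochV. Qed.

Lemma onesub_neq0 n : 1 - q ^+ n.+1 != 0.
Proof.
have := qq_neq0 n.+1; rewrite qpochSr -exprS mulf_eq0; by case/norP.
Qed.

(* The Pascal rule for q-binomial sums, written with the weights
   1/((q)_t (q)_(n-t)) so that no Gaussian binomials are needed. *)
Lemma pascal (u : nat -> nat -> C) n :
  (\sum_(t < n.+2) u t (n.+1 - t)%N / (qpoch q q t * qpoch q q (n.+1 - t)))
    * (1 - q ^+ n.+1) =
  \sum_(t < n.+1) (u t.+1 (n - t)%N + q ^+ t * u t (n - t).+1) /
     (qpoch q q t * qpoch q q (n - t)).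
Proof.
pose v t := u t (n.+1 - t)%N / (qpoch q q t * qpoch q q (n.+1 - t)).
(* Split 1 - q^(n+1) = (1 - q^t) + q^t (1 - q^(n+1-t)); each part cancels the last factor of one of
   the two Pochhammer symbols in the weight. *)
have E (t : 'I_n.+2) : v t * (1 - q ^+ n.+1) =
    v t * (1 - q ^+ t) + v t * (q ^+ t * (1 - q ^+ (n.+1 - t))).
  have -> : q ^+ n.+1 = q ^+ t * q ^+ (n.+1 - t).
    by rewrite -exprD subnKC // -ltnS.
  ring.
rewrite mulr_suml (eq_bigr _ (fun t _ => E t)) big_split /=.
rewrite big_ord_recl /= subrr mulr0 add0r.
rewrite [X in _ + X]big_ord_recr /= subnn expr0 subrr !mulr0 addr0.
rewrite -big_split /=; apply: eq_bigr => t _.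
have tn : (t <= n)%N by rewrite -ltnS.
rewrite /v /bump /= add1n subSS subSn // !qpochSr -!exprS.
have h1 := qq_neq0 t; have h2 := qq_neq0 (n - t).
have h3 := onesub_neq0 t; have h4 := onesub_neq0 (n - t).
move: (u _ _) (u _ _) (q ^+ _.+1) (q ^+ _.+1) (q ^+ t) h3 h4 => A B D D' D'' h3 h4.
by field; rewrite h1 h2 h3 h4.
Qed.

Lemma qbinomial x n :
  \sum_(t < n.+1) q ^+ 'C(t, 2) * x ^+ t / (qpoch q q t * qpoch q q (n - t)) =
  qpoch (- x) q n / qpoch q q n.
Proof.
elim: n x => [|n IH] x; first by rewrite big_ord1 !qpoch0 /= expr0 !mulr1.
apply: (mulIf (onesub_neq0 n)).
rewrite (pascal (fun t _ => q ^+ 'C(t, 2) * x ^+ t)).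
have -> : \sum_(t < n.+1) (q ^+ 'C(t.+1, 2) * x ^+ t.+1 + q ^+ t * (q ^+ 'C(t, 2) * x ^+ t)) /
    (qpoch q q t * qpoch q q (n - t)) =
  (1 + x) * \sum_(t < n.+1) q ^+ 'C(t, 2) * (x * q) ^+ t / (qpoch q q t * qpoch q q (n - t)).
  rewrite mulr_sumr; apply: eq_bigr => t _.
  by rewrite binS bin1 exprD exprMn !exprS; ring.
rewrite IH qpochSl [in RHS]qpochSr -exprS opprK -mulNr.
by field; rewrite qq_neq0 onesub_neq0.
Qed.

(** The Pascal rule takes the sum for n+1 to the sum for n, because (b)_(t+1) b^(n-t) + q^t (b)_t
    b^(n-t+1) = (b)_t b^(n-t). *)
Lemma qcauchy b n :
  \sum_(t < n.+1) qpoch b q t * b ^+ (n - t) / (qpoch q q t * qpoch q q (n - t)) =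
  (qpoch q q n)^-1.
Proof.
elim: n => [|n IH]; first by rewrite big_ord1 !qpoch0 /= expr0 !mulr1 mul1r.
apply: (mulIf (onesub_neq0 n)).
rewrite (pascal (fun t u => qpoch b q t * b ^+ u)).
have -> : (qpoch q q n.+1)^-1 * (1 - q ^+ n.+1) = (qpoch q q n)^-1.
  by rewrite qpochSr -exprS; field; rewrite qq_neq0 onesub_neq0.
rewrite -IH; apply: eq_bigr => t _.
by rewrite qpochSr exprS; ring.
Qed.

Definition euler_sum x : C := tsum (fun n => q ^+ 'C(n, 2) * (x ^+ n / qpoch q q n)).

Lemma abs_summable_bin2 (g : nat -> C) : exp_bounded id g -> abs_summable (fun n => q ^+ 'C(n,
    2) * g n).
Proof.
move=> hg; apply: (@abs_summable_quad _ q q0 q1 _ id (fun n => 'C(n, 2)%:Z) g) => //.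
  exact: size_summable_nat.
by move=> A; exists (A * A.+1)%N => n; have := bin2_ge A n; lia.
Qed.

Lemma abs_summable_eu x : abs_summable (fun n => q ^+ 'C(n, 2) * (x ^+ n / qpoch q q n)).
Proof. by apply: abs_summable_bin2; apply: exp_boundedM; [exact: exp_bounded_exp | exact:
    exp_bounded_qq]. Qed.

Lemma tsum_shift (f : nat -> C) : abs_summable f -> f 0%N = 0 -> tsum f = tsum (fun n => f n.+1).
Proof.
move=> sf f0; apply: (tsum_inj (h := succn)) => //; first exact: succn_inj.
by case=> [|n] // /(_ n); rewrite eqxx.
Qed.

Lemma abs_summable_shift (f : nat -> C) : abs_summable f -> abs_summable (fun n => f n.+1).
Proof. by apply: abs_summable_comp; exact: succn_inj. Qed.

(** In the difference of the series at x and at x q, the factor 1 - q^n cancels the last factor of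
    (q)_n, and a shift of n gives x times the series at x q. *)
Lemma euler_sum_rec x : euler_sum x = (1 + x) * euler_sum (x * q).
Proof.
apply/eqP; rewrite mulrDl mul1r addrC -subr_eq; apply/eqP.
rewrite /euler_sum -tsum_sub -?tsum_scale; try exact: abs_summable_eu.
rewrite tsum_shift.
- apply: tsum_ext => n; rewrite binS bin1 qpochSr -exprS exprD !exprMn !exprS.
  have := onesub_neq0 n; rewrite exprS => h; by field; rewrite qq_neq0 h.
- apply: abs_summable_ext (abs_summable_add (abs_summable_eu x) (abs_summable_scale (-1)
    (abs_summable_eu (x * q)))) => n.
  by rewrite mulN1r.
- by rewrite !expr0 subrr.
Qed.

Lemma euler_sum_iter x n : euler_sum x = qpoch (- x) q n * euler_sum (x * q ^+ n).
Proof.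
elim: n => [|n IH]; first by rewrite qpoch0 mul1r expr0 mulr1.
by rewrite IH euler_sum_rec qpochSr exprSr mulNr opprK !mulrA.
Qed.

Lemma euler_sum_near1 x : exists M : R, forall n, normc (euler_sum (x * q ^+ n) - 1) <= M *
    normc q ^+ n.
Proof.
have sx := abs_summable_shift (abs_summable_eu x).
case: (sx) => M hM; exists M => m.
pose z := x * q ^+ m.
have -> : euler_sum z - 1 = tsum (fun n => q ^+ 'C(n.+1, 2) * (z ^+ n.+1 / qpoch q q n.+1)).
  pose f n := q ^+ 'C(n, 2) * (z ^+ n / qpoch q q n) - (n == 0)%:R.
  have s0 := abs_summable_inj (f := fun n => (n == 0%N)%:R : C) (h := fun _ : unit => 0%N).
  have {}s0 : abs_summable (fun n => (n == 0%N)%:R : C).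
    apply/s0; [by move=> [] []| | exact: (tsum_fin _).2].
    by move=> [|n] // /(_ tt); rewrite eqxx.
  have E1 : tsum (fun n => (n == 0%N)%:R : C) = 1.
    rewrite (@tsum_ord 1) ?big_ord1 //; by case.
  rewrite -E1 /euler_sum -tsum_sub //; last exact: abs_summable_eu.
  rewrite tsum_shift; first by apply: tsum_ext => n; rewrite /= subr0.
    apply: abs_summable_ext (abs_summable_add (abs_summable_eu z) (abs_summable_scale (-1) s0))
        => n.
    by rewrite mulN1r.
  by rewrite !expr0 qpoch0 divr1 mulr1 subrr.
apply: tsum_le => B uB.
apply: le_trans (_ : \sum_(n <- B) normc (q ^+ 'C(n.+1, 2) * (x ^+ n.+1 / qpoch q q n.+1)) *
    normc q ^+ m <= _).
  apply: ler_sum => n _.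
  rewrite /z exprMn -normcX -normcM.
  have -> : q ^+ 'C(n.+1, 2) * (x ^+ n.+1 * (q ^+ m) ^+ n.+1 / qpoch q q n.+1) =
    q ^+ 'C(n.+1, 2) * (x ^+ n.+1 / qpoch q q n.+1) * q ^+ m * (q ^+ m) ^+ n.
    by rewrite [(q ^+ m) ^+ n.+1]exprS; ring.
  rewrite (normcM _ ((q ^+ m) ^+ n)) ler_piMr ?normc_ge0 //.
  by rewrite -exprM normcX exprn_ile1 ?normc_ge0.
by rewrite -mulr_suml ler_wpM2r ?exprn_ge0 ?normc_ge0 ?hM.
Qed.

(** Iterating the functional equation gives S(x) = P_n v_n with v_n = S(x q^n) tending to 1. Once
    |v_n| >= 1/2, the product P_n is bounded by 2 |S(x)|, and P_n - S(x) = P_n (1 - v_n). This also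
    shows that the limit defining [qpoch_inf] exists. *)
Lemma euler_cv x e : 0 < e ->
  exists N, forall n, (N <= n)%N -> normc (qpoch (- x) q n - euler_sum x) < e.
Proof.
move=> e0.
have [M hM] := euler_sum_near1 x.
have M0 : 0 <= M by have := le_trans (normc_ge0 _) (hM 0%N); rewrite expr0 mulr1.
pose L := normc (euler_sum x).
have L0 : 0 <= L by exact: normc_ge0.
(* The bound 1/2 keeps v_n away from 0; the other one makes 2 L d smaller than e, with the added 1
   covering L = 0. *)
pose d := Num.min (1 / 2) (e / (2 * L + 1)).
have d0 : 0 < d by rewrite lt_min !divr_gt0 // ltr_wpDl // mulr_ge0.
have [N hN] := @expr_small _ (normc q) (d / (M + 1))
  ltac:(by rewrite normc_ge0) ltac:(by rewrite divr_gt0 // ltr_wpDl).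
exists N => n /hN h.
have {}h : normc (euler_sum (x * q ^+ n) - 1) < d.
  apply: le_lt_trans (hM n) _.
  apply: le_lt_trans (_ : (M + 1) * normc q ^+ n < _).
    by rewrite ler_wpM2r ?exprn_ge0 ?normc_ge0 // lerDl.
  by rewrite mulrC -ltr_pdivlMr // ltr_wpDl.
move: h; rewrite /d lt_min => /andP[h1 h2].
have := euler_sum_iter x n; move: (euler_sum (x * q ^+ n)) (qpoch (- x) q n) h1 h2 => v u h1 h2 E.
have v12 : 1 / 2 <= normc v.
  have := le_normcD (1 - v) v; rewrite subrK normc1 normc_distC; lra.
have u2 : normc u <= 2 * L.
  rewrite /L E normcM; have := normc_ge0 u; nra.
have -> : u - euler_sum x = u * (1 - v) by rewrite E; ring.
rewrite normcM normc_distC.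
apply: le_lt_trans (_ : 2 * L * normc (v - 1) < _).
  by rewrite ler_wpM2r ?normc_ge0.
move: h2; rewrite ltr_pdivlMr; last by rewrite ltr_wpDl // mulr_ge0.
by have := normc_ge0 (v - 1); nra.
Qed.

Lemma euler x : qpoch_inf (- x) q = euler_sum x.
Proof. by apply: lim_normc => e; exact: euler_cv. Qed.

End Base.
End Pochhammer.

(** * Durfee, 1phi1 and Lebesgue identities *)

Section Products.
Variable R : realType.
Local Notation C := R[i].
Implicit Types (a q x y : C).

Definition seq_lim (u : nat -> C) (l : C) : Prop :=
  forall e : R, 0 < e -> exists N, forall n, (N <= n)%N -> normc (u n - l) < e.

Lemma seq_lim_unique u l l' : seq_lim u l -> seq_lim u l' -> l = l'.
Proof. by move=> /lim_normc <- /lim_normc <-. Qed.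

Lemma seq_lim_mul u v l m : seq_lim u l -> seq_lim v m -> seq_lim (fun n => u n * v n) (l * m).
Proof.
move=> hu hv e e0.
have l0 := normc_ge0 l; have m0 := normc_ge0 m.
pose B := normc l + normc m + 1.
have B0 : 0 < B by rewrite /B; lra.
pose d := Num.min 1 (e / 2 / B).
have d0 : 0 < d by rewrite lt_min ltr01 !divr_gt0.
have [N1 h1] := hu d d0; have [N2 h2] := hv d d0.
exists (maxn N1 N2) => n; rewrite geq_max => /andP[/h1 + /h2].
rewrite /d !lt_min => /andP[a1 a2] /andP[b1 b2].
have -> : u n * v n - l * m = (u n - l) * (v n - m) + ((u n - l) * m + l * (v n - m)).
  by ring.
apply: le_lt_trans (le_normcD _ _) _.
apply: le_lt_trans (lerD (lexx _) (le_normcD _ _)) _; rewrite !normcM.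
move: a2 b2; rewrite !ltr_pdivlMr // /B.
move: (normc_ge0 (u n - l)) (normc_ge0 (v n - m)) a1 b1.
move: (normc (u n - l)) (normc (v n - m)) (normc l) (normc m) l0 m0 {h1 h2 B B0 d d0} => A1 A2
    L M.
nra.
Qed.

Section Base.
Variable q : C.
Hypothesis q0 : q != 0.
Hypothesis q1 : normc q < 1.

Let q1' : normc q <= 1. Proof. exact: ltW. Qed.
Let qn0 := qq_neq0 q1.

Lemma qpoch_cv a : seq_lim (qpoch a q) (qpoch_inf a q).
Proof. by rewrite -[a]opprK (euler q0 q1); exact: (euler_cv q0 q1). Qed.

Lemma qpoch_inf_split a n : qpoch_inf a q = qpoch a q n * qpoch_inf (a * q ^+ n) q.
Proof.
by rewrite -[a]opprK mulNr !(euler q0 q1) (euler_sum_iter q0 q1 _ n).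
Qed.

(** Expand the infinite product by Euler and collect t + u = n, using C(t+u, 2) = C(t, 2) + C(u, 2)
    + t u. The infinite identities below are thereby reduced to finite q-binomial sums. *)
Lemma conv_euler (a : nat -> C) d : exp_bounded id a ->
  tsum (fun t => q ^+ 'C(t, 2) * (a t / qpoch q q t * qpoch_inf (- (d * q ^+ t)) q)) =
  tsum (fun n => q ^+ 'C(n, 2) *
     \sum_(t < n.+1) a t * d ^+ (n - t) / (qpoch q q t * qpoch q q (n - t))).
Proof.
move=> ha.
pose f (p : nat * nat) := q ^+ 'C(p.1 + p.2, 2) *
  (a p.1 / qpoch q q p.1 * (d ^+ p.2 / qpoch q q p.2)).
have sf : abs_summable f.
  apply: (@abs_summable_quad _ q q0 q1 _ (fun p => p.1 + p.2)%N (fun p => 'C(p.1 + p.2, 2)%:Z)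
    (fun p => a p.1 / qpoch q q p.1 * (d ^+ p.2 / qpoch q q p.2))).
  - exact: (size_summable_mul (size_summable_nat q1) (size_summable_nat q1)).
  - apply: exp_boundedM.
      apply: (exp_bounded_nat (phi := fst) (g := fun t => a t / qpoch q q t)).
        by move=> p; exact: leq_addr.
      by apply: exp_boundedM => //; exact: exp_bounded_qq.
    apply: (exp_bounded_nat (phi := snd) (g := fun t => d ^+ t / qpoch q q t)).
      by move=> p; exact: leq_addl.
    by apply: exp_boundedM; [exact: exp_bounded_exp | exact: exp_bounded_qq].
  - move=> A; exists (A * A.+1)%N => p; have := bin2_ge A (p.1 + p.2); lia.
have [E _] := tsum_regroup sf.
transitivity (tsum f); last first.
  rewrite E; apply: tsum_ext => n; rewrite mulr_sumr; apply: eq_bigr => t _.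
  have tn : (t <= n)%N by rewrite -ltnS.
  rewrite /f /= subnKC //; congr (_ * _).
  by field; rewrite !qn0.
rewrite fubini //; apply: tsum_ext => t.
rewrite (euler q0 q1) /euler_sum mulrA -tsum_scale; last exact: abs_summable_eu.
apply: tsum_ext => u; rewrite /f /= bin2D !exprD exprMn -exprM.
by field; rewrite !qn0.
Qed.

(** Cauchy's identity with its denominators cleared, so that it is available before the infinite
    products are known to be nonzero. The inner finite sum is a multiple of (1; q)_n, which vanishes
    for n > 0. *)
Lemma durfee c :
  tsum (fun t => q ^+ 'C(t, 2) * (q ^+ 'C(t, 2) * c ^+ t / qpoch q q t * qpoch_inf (c * q ^+ t)
      q)) = 1.
Proof.
have := @conv_euler (fun t => q ^+ 'C(t, 2) * c ^+ t) (- c) _.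
under tsum_ext do rewrite mulNr opprK.
move=> -> //; last first.
  apply: exp_boundedM; last exact: exp_bounded_exp.
  exists 1, 1; split=> // n; rewrite expr1n mulr1 normcX exprn_ile1 ?normc_ge0 //.
rewrite (@tsum_ord _ 1) ?big_ord1 /=.
  by rewrite ?big_ord1 /= !qpoch0 !expr0 !(mulr1, invr1).
case=> // n _.
have -> : \sum_(t < n.+2) q ^+ 'C(t, 2) * c ^+ t * (- c) ^+ (n.+1 - t) /
    (qpoch q q t * qpoch q q (n.+1 - t)) = (- c) ^+ n.+1 *
    \sum_(t < n.+2) q ^+ 'C(t, 2) * (- 1) ^+ t / (qpoch q q t * qpoch q q (n.+1 - t)).
  rewrite mulr_sumr; apply: eq_bigr => t _.
  have tn : (t <= n.+1)%N by rewrite -ltnS.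
  have -> : (- c) ^+ n.+1 = (- c) ^+ (n.+1 - t) * (- c) ^+ t by rewrite -exprD subnK.
  have -> : c ^+ t = (- c) ^+ t * (- 1) ^+ t by rewrite -exprMn mulrN1 opprK.
  ring.
by rewrite (qbinomial q1) opprK qpoch1 mul0r !mulr0.
Qed.

(** If (c)_oo were 0, so would be every (c q^t)_oo, since (c)_t is nonzero; the sum in [durfee]
    would then be 0 and not 1. *)
Lemma qpoch_inf_neq0 c : normc c < 1 -> qpoch_inf c q != 0.
Proof.
move=> c1; apply/eqP => H; have := durfee c.
rewrite (@tsum_ext _ _ _ (fun=> 0)) => [|t].
  by rewrite (tsumE (@has_tsum_0 _ _)) => /esym/eqP; rewrite oner_eq0.
have := qpoch_inf_split c t; rewrite H => /esym/eqP; rewrite mulf_eq0.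
by rewrite (negbTE (qpoch_neq0 t c1 q1')) /= => /eqP ->; rewrite !mulr0.
Qed.

Lemma qpoch_inf_ratio c t : normc c < 1 ->
  qpoch_inf (c * q ^+ t) q = qpoch_inf c q / qpoch c q t.
Proof.
move=> c1; rewrite [in RHS](qpoch_inf_split c t) mulrAC divff ?mul1r //; exact: qpoch_neq0.
Qed.

(* The summable 1phi1 series, in the form with all signs positive. *)
Lemma phi11_sum b y : normc (b * y) < 1 ->
  tsum (fun t => q ^+ 'C(t, 2) * y ^+ t * qpoch (- b) q t / (qpoch q q t * qpoch (b * y) q t)) =
  qpoch_inf (- y) q / qpoch_inf (b * y) q.
Proof.
move=> by1; apply: (mulIf (qpoch_inf_neq0 by1)); rewrite divfK ?qpoch_inf_neq0 //.
have ea : exp_bounded id (fun t => y ^+ t * qpoch (- b) q t).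
  by apply: exp_boundedM; [exact: exp_bounded_exp | exact: exp_bounded_qpoch].
rewrite mulrC -tsum_scale; last first.
  apply: abs_summable_ext (abs_summable_bin2 q0 q1 (g := fun t => y ^+ t * qpoch (- b) q t *
      (qpoch q q t)^-1 * (qpoch (b * y) q t)^-1) _) => [t|].
    by field; rewrite qn0 qpoch_neq0.
  by do !apply: exp_boundedM; [exact: exp_bounded_exp|exact: exp_bounded_qpoch|exact:
      exp_bounded_qq|exact: exp_bounded_qpochV].
have <- : tsum (fun t => q ^+ 'C(t, 2) * (y ^+ t * qpoch (- b) q t / qpoch q q t *
    qpoch_inf (- (- (b * y) * q ^+ t)) q)) = qpoch_inf (- y) q.
  (* The inner sum collapses to y^n / (q)_n by [qcauchy] at -b, which leaves Euler's series for
     (-y)_oo. *)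
  rewrite (conv_euler _ ea) (euler q0 q1); apply: tsum_ext => n; congr (_ * _).
  rewrite -(qcauchy q1 (- b) n) mulr_sumr; apply: eq_bigr => t _.
  have tn : (t <= n)%N by rewrite -ltnS.
  have -> : y ^+ n = y ^+ (n - t) * y ^+ t by rewrite -exprD subnK.
  by rewrite -mulNr exprMn; ring.
apply: tsum_ext => t; rewrite mulNr opprK (qpoch_inf_ratio _ by1).
by field; rewrite qn0 qpoch_neq0.
Qed.

End Base.

Section Doubling.
Variable q : C.
Hypothesis q0 : q != 0.
Hypothesis q1 : normc q < 1.

Lemma sq_neq0 : q ^+ 2 != 0.
Proof. exact: expf_neq0. Qed.

Lemma sq_lt1 : normc (q ^+ 2) < 1.
Proof. by rewrite normcX exprn_ilt1 ?normc_ge0. Qed.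

Lemma qpoch_inf_double a :
  qpoch_inf a q = qpoch_inf a (q ^+ 2) * qpoch_inf (a * q) (q ^+ 2).
Proof.
apply: (seq_lim_unique (u := fun n => qpoch a q n.*2)).
  move=> e e0; have [N hN] := qpoch_cv q0 q1 a e0.
  by exists N => n Nn; apply: hN; rewrite -addnn (leq_trans Nn) // leq_addr.
have E : (fun n => qpoch a q n.*2) =1 (fun n => qpoch a (q ^+ 2) n * qpoch (a * q) (q ^+ 2) n).
  by move=> n; exact: qpoch_double.
rewrite (funext E); apply: seq_lim_mul; apply: qpoch_cv; rewrite ?sq_neq0 ?sq_lt1 //.
Qed.

Lemma qpoch_inf_sqr a :
  qpoch_inf a q * qpoch_inf (- a) q = qpoch_inf (a ^+ 2) (q ^+ 2).
Proof.
apply: (seq_lim_unique (u := fun n => qpoch a q n * qpoch (- a) q n)).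
  by apply: seq_lim_mul; exact: qpoch_cv.
rewrite (funext (fun n => qpoch_sqr a q n)).
by apply: qpoch_cv; rewrite ?sq_neq0 ?sq_lt1.
Qed.

(** Expand (-y)_s by the q-binomial theorem and use [conv_euler] backwards with d = q. The
    denominators become (q)_t (-q)_t = (q^2; q^2)_t, and Euler's series in base q^2 remains. *)
Lemma lebesgue y :
  tsum (fun s => q ^+ 'C(s, 2) * (q ^+ s * qpoch (- y) q s / qpoch q q s)) =
  qpoch_inf (- (y * q)) (q ^+ 2) * qpoch_inf (- q) q.
Proof.
have Q0 := sq_neq0; have Q1 := sq_lt1.
have q1' : normc q <= 1 by exact: ltW.
have nq1 : normc (- q) < 1 by rewrite normcN.
have ea : exp_bounded id (fun t => q ^+ t * (q ^+ 'C(t, 2) * y ^+ t)).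
  apply: exp_boundedM; first exact: exp_bounded_exp.
  apply: exp_boundedM; last exact: exp_bounded_exp.
  exists 1, 1; split=> // n; rewrite expr1n mulr1 normcX exprn_ile1 ?normc_ge0 //.
have E := conv_euler q0 q1 q ea.
rewrite (euler Q0 Q1) mulrC -tsum_scale; last exact: abs_summable_eu.
have -> : tsum (fun s => q ^+ 'C(s, 2) * (q ^+ s * qpoch (- y) q s / qpoch q q s)) =
  tsum (fun n => q ^+ 'C(n, 2) * \sum_(t < n.+1) (q ^+ t * (q ^+ 'C(t, 2) * y ^+ t)) *
     q ^+ (n - t) / (qpoch q q t * qpoch q q (n - t))).
  apply: tsum_ext => n; congr (_ * _).
  rewrite -mulrA -(qbinomial q1) mulr_sumr; apply: eq_bigr => t _.
  have tn : (t <= n)%N by rewrite -ltnS.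
  have -> : q ^+ n = q ^+ (n - t) * q ^+ t by rewrite -exprD subnK.
  ring.
rewrite -E; apply: tsum_ext => t.
rewrite -mulNr (qpoch_inf_ratio q0 q1 _ nq1).
have := qpoch_sqr q q t => <-.
have := qq_neq0 q1 t; have := qpoch_neq0 t nq1 q1' => h1 h2.
have -> : (q ^+ 2) ^+ 'C(t, 2) = q ^+ 'C(t, 2) * q ^+ 'C(t, 2).
  by rewrite -exprM mul2n -addnn exprD.
by rewrite exprMn; field; rewrite h1 h2.
Qed.

End Doubling.
End Products.

(** With B arbitrary, a square dominates any linear term up to a constant; the growth conditions on
    the exponents below rest on it. *)
Lemma mulz_le_sqrD (n B : int) : B * n <= n * n + B * B.
Proof. nia. Qed.

(** * Bilateral series and the Jacobi triple product *)

Section Bilateral.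
Variable R : realType.
Local Notation C := R[i].

Definition int_pos (m : int) : nat := if m is Posz n then n else 0.
Definition int_neg (m : int) : nat := if m is Negz n then n.+1 else 0.

(** The pair of naturals with prescribed difference and prescribed minimum. *)
Definition diffmin (p : int * nat) : nat * nat :=
  (p.2 + int_pos p.1, p.2 + int_neg p.1)%N.

Lemma diffmin_bij : bijective diffmin.
Proof.
exists (fun p => (p.1%:Z - p.2%:Z, minn p.1 p.2)).
  by move=> [[m|m] j] /=; rewrite /diffmin /=; congr pair; lia.
move=> [i j]; rewrite /diffmin /=.
have [ij|ij] := leqP j i.
  have -> : i%:Z - j%:Z = Posz (i - j) by lia.
  by rewrite /=; congr pair; lia.
have -> : i%:Z - j%:Z = Negz (j - i).-1 by lia.
by rewrite /=; congr pair; lia.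
Qed.

Section Base.
Variable q : C.
Hypothesis q0 : q != 0.
Hypothesis q1 : normc q < 1.
Let qn0 := qq_neq0 q1.

Lemma abs_summable_durfee_rect n :
  abs_summable (fun j => q ^+ (j * (j + n)) / (qpoch q q j * qpoch q q (j + n))).
Proof.
have b : exp_bounded id (fun t => q ^+ 'C(t,2) * ((q ^+ n.+1) ^+ t / qpoch q q t *
    ((qpoch (q ^+ n.+1) q t)^-1 * (qpoch q q n)^-1))).
  apply: exp_boundedM; last apply: exp_boundedM.
  - exists 1, 1; split=> // t.
    by rewrite expr1n mulr1 normcX exprn_ile1 ?normc_ge0 ?ltW.
  - by apply: exp_boundedM; [exact: exp_bounded_exp | exact: exp_bounded_qq].
  - apply: exp_boundedM; last exact: exp_bounded_const.
    apply: exp_bounded_qpochV; last exact: ltW.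
    by rewrite normcX exprn_ilt1 ?normc_ge0.
apply: abs_summable_ext (abs_summable_bin2 q0 q1 b) => t.
have -> : (t * (t + n) = 'C(t, 2) + 'C(t, 2) + n.+1 * t)%N.
  by have := bin2_sqr t; lia.
rewrite (addnC t n) (qpochD q q n t) -exprS.
have h : qpoch (q ^+ n.+1) q t != 0.
  by apply: qpoch_neq0; rewrite ?ltW // normcX exprn_ilt1 ?normc_ge0.
by rewrite exprD (exprM q n.+1 t) exprD; field; rewrite !qn0 h.
Qed.

(** This is [durfee] at c = q^(n+1), since j (j + n) = 2 C(j, 2) + (n + 1) j. *)
Lemma durfee_rect n :
  tsum (fun j => q ^+ (j * (j + n)) / (qpoch q q j * qpoch q q (j + n))) =
  (qpoch_inf q q)^-1.
Proof.
have i0 := qpoch_inf_neq0 q0 q1 q1.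
apply: (mulfI i0); rewrite divff // -(durfee q0 q1 (q ^+ n.+1)).
rewrite -tsum_scale; last exact: abs_summable_durfee_rect.
apply: tsum_ext => t.
have -> : q ^+ n.+1 * q ^+ t = q * q ^+ (t + n).
  by rewrite -exprD -exprS addSn addnC.
rewrite (qpoch_inf_ratio q0 q1 _ q1).
have -> : (t * (t + n) = 'C(t, 2) + 'C(t, 2) + n.+1 * t)%N.
  by have := bin2_sqr t; lia.
rewrite (exprD _ ('C(t, 2) + 'C(t, 2))) (exprM q n.+1 t) exprD.
by field; rewrite !qn0.
Qed.

(** Group the pairs by their difference m: the sum over the minimum is a Durfee rectangle sum, whose
    value 1/(q)_oo does not depend on m. *)
Lemma durfee_bilateral (w : int -> C) :
  abs_summable (fun p : nat * nat => q ^+ (p.1 * p.2) * w (p.1%:Z - p.2%:Z) /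
     (qpoch q q p.1 * qpoch q q p.2)) ->
  tsum (fun p : nat * nat => q ^+ (p.1 * p.2) * w (p.1%:Z - p.2%:Z) /
     (qpoch q q p.1 * qpoch q q p.2)) = tsum w / qpoch_inf q q /\ abs_summable w.
Proof.
have i0 := qpoch_inf_neq0 q0 q1 q1.
set f := (fun p : nat * nat => _) => sf.
have sfd : abs_summable (fun p => f (diffmin p)) by apply/(abs_summable_bij f diffmin_bij).
have E m : tsum (fun j => f (diffmin (m, j))) = (qpoch_inf q q)^-1 * w m.
  rewrite -(durfee_rect `|m|) mulrC -tsum_scale; last exact: abs_summable_durfee_rect.
  apply: tsum_ext => j; rewrite /f /diffmin /=.
  have -> : (j + int_pos m)%:Z - (j + int_neg m)%:Z = m by case: m => m /=; lia.
  case: m => m /=; rewrite ?addn0 ?absz_nat //; first by rewrite mulnC (mulrC (qpoch q q j));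
      ring.
  by ring.
have sw : abs_summable w.
  apply: abs_summable_ext (abs_summable_scale (qpoch_inf q q) (abs_summable_outer sfd)) => m.
  by rewrite E mulVKf.
split=> //; rewrite (tsum_bij diffmin_bij sf) fubini //.
by rewrite mulrC -tsum_scale //; apply: tsum_ext => m; rewrite E.
Qed.

End Base.

Section Theta.
Variable g : C.
Hypothesis g0 : g != 0.
Hypothesis g1 : normc g < 1.

(** Multiply the Euler series, in base g^2, of the two products that contain x. From g^(i^2 + j^2) =
    g^(2 i j) g^((i - j)^2) the double series has the shape treated by [durfee_bilateral]. *)
Lemma jtp x : x != 0 ->
  tsum (fun m : int => g ^ (m * m) * x ^ m) =
  qpoch_inf (g ^+ 2) (g ^+ 2) * qpoch_inf (- (x * g)) (g ^+ 2) *
  qpoch_inf (- (g / x)) (g ^+ 2) /\ abs_summable (fun m : int => g ^ (m * m) * x ^ m).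
Proof.
move=> x0; set q := g ^+ 2.
have q0 : q != 0 by exact: sq_neq0.
have q1 : normc q < 1 by exact: sq_lt1.
have s1 := abs_summable_eu q0 q1 (x * g); have s2 := abs_summable_eu q0 q1 (g / x).
have sq n : q ^+ 'C(n, 2) * g ^+ n = g ^ (n%:Z * n%:Z).
  by rewrite -exprM -exprD mul2n bin2_sqr.
have E (p : nat * nat) : q ^+ 'C(p.1, 2) * ((x * g) ^+ p.1 / qpoch q q p.1) *
    (q ^+ 'C(p.2, 2) * ((g / x) ^+ p.2 / qpoch q q p.2)) =
   q ^+ (p.1 * p.2) * (g ^ ((p.1%:Z - p.2%:Z) * (p.1%:Z - p.2%:Z)) * x ^ (p.1%:Z - p.2%:Z)) /
     (qpoch q q p.1 * qpoch q q p.2).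
  case: p => i j /=; have := qq_neq0 q1 i; have := qq_neq0 q1 j => hj hi.
  have -> : q ^+ (i * j) * (g ^ ((i%:Z - j%:Z) * (i%:Z - j%:Z)) * x ^ (i%:Z - j%:Z)) =
     (q ^+ 'C(i, 2) * g ^+ i) * (q ^+ 'C(j, 2) * g ^+ j) * (x ^+ i / x ^+ j).
    have e : q ^+ (i * j) * g ^ ((i%:Z - j%:Z) * (i%:Z - j%:Z)) =
        g ^ (i%:Z * i%:Z) * g ^ (j%:Z * j%:Z).
      by rewrite -exprM exprnP -!expfzDr //; congr (g ^ _); lia.
    by rewrite [LHS]mulrA e !sq expfzDr // -exprnN.
  by rewrite !exprMn exprVn; field; rewrite hi hj expf_neq0.
have sf := abs_summable_ext E (abs_summable_mul s1 s2).
have [H sw] := durfee_bilateral q0 q1 (w := fun m => g ^ (m * m) * x ^ m) sf.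
split=> //.
rewrite (euler q0 q1) (euler q0 q1) -mulrA -tsum_mul // (tsum_ext E) H mulrC divfK //.
exact: qpoch_inf_neq0.
Qed.

End Theta.
End Bilateral.

(** * Shifted theta functions and the double series in i and j *)

Section Tadpole.
Variable R : realType.
Local Notation C := R[i].
Variable h : C.
Hypothesis h0 : h != 0.
Hypothesis h1 : normc h < 1.
Local Notation q := (h ^+ 2).

Let q0 : q != 0. Proof. exact: sq_neq0. Qed.
Let q1 : normc q < 1. Proof. exact: sq_lt1. Qed.

Definition theta (a : int) : C := tsum (fun m : int => h ^ (2 * (m * m) + a * m)).

Lemma theta_jtp a :
  theta a = qpoch_inf (q ^+ 2) (q ^+ 2) * qpoch_inf (- (h ^ (a + 2))) (q ^+ 2) *
    qpoch_inf (- (h ^ (2 - a))) (q ^+ 2) /\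
  abs_summable (fun m : int => h ^ (2 * (m * m) + a * m)).
Proof.
have x0 : h ^ a != 0 by rewrite expfz_neq0.
have [H sw] := jtp q0 q1 x0.
have E (m : int) : q ^ (m * m) * (h ^ a) ^ m = h ^ (2 * (m * m) + a * m).
  by rewrite exprnP !exprz_exp -expfzDr.
split; last exact: abs_summable_ext E sw.
rewrite /theta -(tsum_ext E) H.
have -> : h ^ (a + 2) = h ^ a * q by rewrite expfzDr.
by have -> : h ^ (2 - a) = q / h ^ a by rewrite expfzDr // invr_expz.
Qed.

Lemma abs_summable_theta a : abs_summable (fun m : int => h ^ (2 * (m * m) + a * m)).
Proof. by case: (theta_jtp a). Qed.

Lemma addz_bij (c : int) : bijective (fun m : int => m + c).
Proof. by exists (fun m => m - c) => m; rewrite (addrK, subrK). Qed.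

Lemma oppz_bij : bijective (fun m : int => - m).
Proof. by exists (fun m => - m) => m; rewrite opprK. Qed.

(** Translate m by 1. A shift of a by 4 thus costs only a power of h, which is what later pulls
    theta out of the series over r. *)
Lemma thetaD4 a : theta (a + 4) = h ^ (- 2 - a) * theta a.
Proof.
rewrite [in RHS]/theta (tsum_bij (addz_bij 1) (abs_summable_theta a)) -tsum_scale.
  by apply: tsum_ext => m; rewrite -expfzDr //; congr (h ^ _); ring.
exact: (abs_summable_comp (h := fun m : int => m + 1) (@addIr _ 1) (abs_summable_theta a)).
Qed.

Lemma thetaN a : theta (- a) = theta a.
Proof.
rewrite [in RHS]/theta (tsum_bij oppz_bij (abs_summable_theta a)).
by apply: tsum_ext => m; congr (h ^ _); ring.
Qed.

Lemma thetaD4n a (n : nat) :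
  theta (a + 4 * n%:Z) = h ^ (- (2 * (n%:Z * n%:Z)) - a * n%:Z) * theta a.
Proof.
elim: n => [|n IH]; first by rewrite !mulr0 addr0 subr0 oppr0 mul1r.
have -> : a + 4 * n.+1%:Z = a + 4 * n%:Z + 4 by lia.
rewrite thetaD4 IH mulrA -expfzDr //; congr (h ^ _ * _); lia.
Qed.

(** The exponent is i^2 + (i - j)^2 + (j - k)^2 + a (i - j) with k^2 removed. *)
Definition ij_term (k : nat) (a : int) (p : nat * nat) : C :=
  let i := p.1%:Z in let j := p.2%:Z in
  h ^ (2 * (i * i) - 2 * (i * j) + 2 * (j * j) - 2 * k%:Z * j + a * (i - j))
    * (qpoch q q p.1 * qpoch q q p.2)^-1.

Lemma exp_bounded_qq1 (I : Type) (s : I -> nat) (phi : I -> nat) :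
  (forall x, (phi x <= s x)%N) -> exp_bounded s (fun x => (qpoch q q (phi x))^-1).
Proof. move=> hs; exact: (exp_bounded_nat hs (exp_bounded_qq q1)). Qed.

Lemma abs_summable_ij_term k a : abs_summable (ij_term k a).
Proof.
apply: (@abs_summable_quad _ h h0 h1 _ (fun p => p.1 + p.2)%N
  (fun p => let i := p.1%:Z in let j := p.2%:Z in
    2 * (i * i) - 2 * (i * j) + 2 * (j * j) - 2 * k%:Z * j + a * (i - j))
  (fun p => (qpoch q q p.1 * qpoch q q p.2)^-1)).
- exact: (size_summable_mul (size_summable_nat h1) (size_summable_nat h1)).
- rewrite (_ : (fun p => _) = (fun p : nat * nat => (qpoch q q p.1)^-1 * (qpoch q q p.2)^-1)).
    by apply: exp_boundedM; apply: exp_bounded_qq1 => p; rewrite ?leq_addr ?leq_addl.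
  by apply/funext => p; rewrite invfM.
(* The quadratic part is i^2 + j^2 + (i - j)^2; the squares of i and j absorb the linear terms (A -
   a) i and (A + a + 2k) j. *)
- move=> A; exists ((A%:Z - a) * (A%:Z - a) + (A%:Z + a + 2 * k%:Z) * (A%:Z + a + 2 * k%:Z)) =>
    -[i j] /=.
  have := mulz_le_sqrD i%:Z (A%:Z - a); have := mulz_le_sqrD j%:Z (A%:Z + a + 2 * k%:Z).
  have := sqr_ge0 (i%:Z - j%:Z); rewrite expr2.
  nia.
Qed.

End Tadpole.

(** * The recursion in k and convergence of the quadruple series *)

Section Tadpole4.
Variable R : realType.
Local Notation C := R[i].
Variable h : C.
Hypothesis h0 : h != 0.
Hypothesis h1 : normc h < 1.
Local Notation q := (h ^+ 2).
Local Notation theta := (theta h).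
Local Notation ij_term := (ij_term h).

Let q0 : q != 0. Proof. exact: sq_neq0. Qed.
Let q1 : normc q < 1. Proof. exact: sq_lt1. Qed.
Let qn0 := qq_neq0 q1.
Let qi0 := qpoch_inf_neq0 q0 q1 q1.

Lemma q_expz (n : nat) : q ^+ n = h ^ (2 * n%:Z).
Proof. by rewrite -exprM. Qed.

Lemma expzq (x : int) : h ^ x * q = h ^ (x + 2).
Proof. by rewrite expfzDr. Qed.

(** At k = 0 the quadratic form is 2 (i - j)^2 + 2 i j, so the series is bilateral in i - j. *)
Lemma tsum_ij_term0 a : tsum (ij_term 0 a) = theta a / qpoch_inf q q.
Proof.
have E p : ij_term 0 a p = q ^+ (p.1 * p.2) *
    h ^ (2 * ((p.1%:Z - p.2%:Z) * (p.1%:Z - p.2%:Z)) + a * (p.1%:Z - p.2%:Z)) /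
    (qpoch q q p.1 * qpoch q q p.2).
  rewrite /ij_term q_expz -expfzDr //; congr (h ^ _ * _); clear; lia.
have [H _] := durfee_bilateral q0 q1 (w := fun m => h ^ (2 * (m * m) + a * m))
  (abs_summable_ext E (abs_summable_ij_term h0 h1 0 a)).
by rewrite (tsum_ext E) H.
Qed.

(** The summands for k + 1 and k differ by the factor q^(-j), and q^(-j) - 1 = q^(-j) (1 - q^j)
    cancels the last factor of (q)_j; then j is shifted by 1. *)
Lemma tsum_ij_termS k a :
  tsum (ij_term k.+1 a) = tsum (ij_term k a) + h ^ (- (2 * k%:Z) - a) * tsum (ij_term k (a - 2)).
Proof.
apply/eqP; rewrite addrC -subr_eq; apply/eqP.
have st k' a' := abs_summable_ij_term h0 h1 k' a'.
rewrite -(tsum_sub (st _ _) (st _ _)) -(tsum_scale _ (st _ _)).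
rewrite (tsum_inj (h := fun p : nat * nat => (p.1, p.2.+1))).
- apply: tsum_ext => -[i j]; rewrite /= /ij_term /=.
  have := onesub_neq0 q1 j; rewrite (exprS q j) => hj.
  rewrite qpochSr invfM mulrA.
  set e1 := (X in h ^ X); set e2 := (X in _ - h ^ X * _); set e3 := (X in _ = _ * (h ^ X * _)).
  have -> : h ^ e2 = h ^ e1 * q ^+ j.+1.
    by rewrite q_expz -expfzDr //; congr (h ^ _); rewrite /e1 /e2; clear; lia.
  have -> : h ^ e1 = h ^ (- (2 * k%:Z) - a) * h ^ e3.
    by rewrite -expfzDr //; congr (h ^ _); rewrite /e1 /e3; clear; lia.
  by rewrite (exprS q j); field; rewrite !qn0 hj.
- by move=> [i j] [i' j'] [-> ->].
- move=> [i [|j]] H; last by have := H (i, j); rewrite eqxx.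
  by rewrite /ij_term /= !mulr0 subrr.
- apply: abs_summable_ext (abs_summable_add (abs_summable_ij_term h0 h1 k.+1 a)
    (abs_summable_scale (-1) (abs_summable_ij_term h0 h1 k a))) => p.
  by rewrite mulN1r.
Qed.

(** The recursion in k matches the Pascal rule: the arguments a - 2 + 2r of the second sum and a +
    2(r + 1) of the raised index differ by 4, so [thetaD4] identifies the terms. *)
Lemma tsum_ij_term k a :
  tsum (ij_term k a) * qpoch_inf q q = qpoch q q k *
    \sum_(r < k.+1) h ^ (- (2 * (r%:Z * (k - r)%N%:Z))) * theta (a + 2 * r%:Z) /
       (qpoch q q r * qpoch q q (k - r)).
Proof.
elim: k a => [|k IH] a.
  by rewrite tsum_ij_term0 divfK // big_ord1 /= !qpoch0 !mulr0 oppr0 expr0z addr0 !mulr1 !mul1r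
      invr1 mulr1.
rewrite tsum_ij_termS mulrDl -mulrA !IH qpochSr -exprS -mulrA [RHS]mulrCA [RHS]mulrC -!mulrA.
rewrite mulrCA -mulrDr; congr (_ * _).
rewrite (pascal q1 (fun r s => h ^ (- (2 * (r%:Z * s%:Z))) * theta (a + 2 * r%:Z))).
rewrite mulr_sumr -big_split /=; apply: eq_bigr => r _.
rewrite [X in _ + X]mulrA -mulrDl; congr (_ / _).
rewrite addrC; congr (_ + _); last first.
  by rewrite q_expz [RHS]mulrA -expfzDr //; congr (h ^ _ * _); clear; lia.
have -> : a + 2 * r.+1%:Z = a - 2 + 2 * r%:Z + 4 by clear; lia.
rewrite thetaD4 // [LHS]mulrA [RHS]mulrA -!expfzDr //; congr (h ^ _ * _).
have rk : (r <= k)%N by rewrite -ltnS.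
rewrite -subzn //; clear; lia.
Qed.

(** The nesting ((k, (i, j)), l) lets Fubini sum over l, then over (i, j), and leave k. *)
Definition tadpole (a b : int) (p : nat * (nat * nat) * nat) : C :=
  let k := p.1.1%:Z in let i := p.1.2.1%:Z in let j := p.1.2.2%:Z in let l := p.2%:Z in
  h ^ (i * i + (i - j) * (i - j) + (j - k) * (j - k) + (k - l) * (k - l)
       + l + a * (i - j) + b * (k - l)) /
  (qpoch q q p.1.1 * (qpoch q q p.1.2.1 * qpoch q q p.1.2.2) * qpoch q q p.2).

Lemma abs_summable_tadpole a b : abs_summable (tadpole a b).
Proof.
apply: (@abs_summable_quad _ h h0 h1 _ (fun p => (p.1.1 + (p.1.2.1 + p.1.2.2)) + p.2)%N
  (fun p => let k := p.1.1%:Z in let i := p.1.2.1%:Z in let j := p.1.2.2%:Z in let l := p.2%:Z in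
  i * i + (i - j) * (i - j) + (j - k) * (j - k) + (k - l) * (k - l)
       + l + a * (i - j) + b * (k - l))
  (fun p => (qpoch q q p.1.1 * (qpoch q q p.1.2.1 * qpoch q q p.1.2.2) * qpoch q q p.2)^-1)).
- have s1 := size_summable_nat h1.
  exact: (size_summable_mul (size_summable_mul s1 (size_summable_mul s1 s1)) s1).
- rewrite (_ : (fun p => _) = (fun p : nat * (nat * nat) * nat => (qpoch q q p.1.1)^-1 *
    ((qpoch q q p.1.2.1)^-1 * (qpoch q q p.1.2.2)^-1) * (qpoch q q p.2)^-1)).
    by do !apply: exp_boundedM; apply: (exp_bounded_qq1 h1) => -[[k [i j]] l] /=; clear; lia.
  by apply/funext => p; rewrite !invfM.
(* The squared numbers are the coefficients of A (i + j + k + l) - l - a (i - j) - b (k - l) when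
   written in i, i - j, j - k and k - l. *)
- move=> A; exists ((4 * A%:Z - 1) * (4 * A%:Z - 1) + (- 3 * A%:Z - a + 1) * (- 3 * A%:Z - a + 1)
    + (- 2 * A%:Z + 1) * (- 2 * A%:Z + 1) + (- A%:Z - b + 1) * (- A%:Z - b + 1)).
  move=> [[k [i j]] l] /=.
  have := mulz_le_sqrD i%:Z (4 * A%:Z - 1).
  have := mulz_le_sqrD (i%:Z - j%:Z) (- 3 * A%:Z - a + 1).
  have := mulz_le_sqrD (j%:Z - k%:Z) (- 2 * A%:Z + 1).
  have := mulz_le_sqrD (k%:Z - l%:Z) (- A%:Z - b + 1).
  lia.
Qed.

(** Each of the first k factors is rewritten by 1 + h^(-x) = h^(-x) (1 + h^x), with x = b, b + 2,
    ..., b + 2k - 2. *)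
Lemma qpoch_inf_reflect (b : int) (k : nat) :
  qpoch_inf (- h ^ (2 - 2 * k%:Z - b)) q =
  h ^ (- (b * k%:Z) - k%:Z * k%:Z + k%:Z) * qpoch (- h ^ b) q k *
  qpoch_inf (- h ^ (2 - b)) q.
Proof.
elim: k => [|k IH].
  by rewrite !mulr0 subr0 oppr0 subr0 addr0 expr0z qpoch0 !mul1r.
rewrite (qpoch_inf_split q0 q1 _ 1) expr1 mulNr expzq.
have -> : 2 - 2 * k.+1%:Z - b + 2 = 2 - 2 * k%:Z - b by clear; lia.
rewrite IH qpochSr qpoch0 qpochSr expr0 mulr1 mul1r opprK mulNr opprK !mulrA.
congr (_ * _); rewrite q_expz -expfzDr //.
set e1 := - (b * k.+1%:Z) - _ + _; set e2 := - (b * k%:Z) - _ + _.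
have -> : h ^ e2 = h ^ e1 * h ^ (b + 2 * k%:Z).
  by rewrite -expfzDr //; congr (h ^ _); rewrite /e1 /e2; clear; lia.
have -> : h ^ (2 - 2 * k.+1%:Z - b) = (h ^ (b + 2 * k%:Z))^-1.
  by rewrite invr_expz; congr (h ^ _); clear; lia.
by field; rewrite expfz_neq0.
Qed.

End Tadpole4.

(** * Reduction to a single series *)

Section Reduction.
Variable R : realType.
Local Notation C := R[i].
Variable h : C.
Hypothesis h0 : h != 0.
Hypothesis h1 : normc h < 1.
Local Notation q := (h ^+ 2).
Local Notation theta := (theta h).
Local Notation ij_term := (ij_term h).
Local Notation tadpole := (tadpole h).

Let q0 : q != 0. Proof. exact: sq_neq0. Qed.
Let q1 : normc q < 1. Proof. exact: sq_lt1. Qed.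
Let qn0 := qq_neq0 q1.
Let qi0 := qpoch_inf_neq0 q0 q1 q1.

Lemma q_bin2 (l : nat) : q ^+ 'C(l, 2) = h ^ (l%:Z * l%:Z - l%:Z).
Proof. by rewrite q_expz //; congr (h ^ _); have := bin2_sqr l; clear; lia. Qed.

(** What the sums over l and over i, j leave at k = r + s, apart from the constant (-h^(2-b))_oo /
    (q)_oo. In the power of h the indices separate: k^2 + k - 2 r s = r^2 + s^2 + r + s. *)
Definition rs_term (a b : int) (p : nat * nat) : C :=
  h ^ (p.1%:Z * p.1%:Z + p.2%:Z * p.2%:Z + p.1%:Z + p.2%:Z) *
  qpoch (- h ^ b) q (p.1 + p.2) * theta (a + 2 * p.1%:Z) /
  (qpoch q q p.1 * qpoch q q p.2).

(** Theta is expanded, and the triple series of exponent (m + r)^2 + m^2 + s^2 + r + s + a m is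
    bounded instead. *)
Lemma abs_summable_rs a b : abs_summable (rs_term a b).
Proof.
pose g (p : nat * nat * int) := qpoch (- h ^ b) q (p.1.1 + p.1.2) /
  (qpoch q q p.1.1 * qpoch q q p.1.2).
pose E (p : nat * nat * int) := let r := p.1.1%:Z in let s := p.1.2%:Z in
  r * r + s * s + r + s + 2 * (p.2 * p.2) + (a + 2 * r) * p.2.
have sf : abs_summable (fun p => h ^ E p * g p).
  apply: (@abs_summable_quad _ h h0 h1 _ (fun p => p.1.1 + p.1.2 + `|p.2|)%N E g).
  - exact: (size_summable_mul (size_summable_mul (size_summable_nat h1) (size_summable_nat h1))
      (size_summable_int h1)).
  - rewrite /g (_ : (fun p => _) = (fun p : nat * nat * int => qpoch (- h ^ b) q (p.1.1 + p.1.2) *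
      ((qpoch q q p.1.1)^-1 * (qpoch q q p.1.2)^-1))).
      apply: exp_boundedM; last by apply: exp_boundedM; apply: (exp_bounded_qq1 h1) => -[[r s]
          m] /=; clear; lia.
      apply: (exp_bounded_nat (phi := fun p : nat * nat * int => (p.1.1 + p.1.2)%N)
        (g := qpoch (- h ^ b) q)) => [[[r s] m] /=|]; first by clear; lia.
      by apply: exp_bounded_qpoch; exact: ltW.
    by apply/funext => p; rewrite invfM.
  (* As r + |m| <= |m + r| + 2 |m|, it suffices to absorb 2A |m| together with a m, A |m + r| and A
     s; both signs of m and m + r are provided for. *)
  - move=> A; exists ((2 * A%:Z - a) * (2 * A%:Z - a) + (2 * A%:Z + a) * (2 * A%:Z + a)
      + A%:Z * A%:Z + A%:Z * A%:Z) => -[[r s] m]; rewrite /E /=.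
    have H1 := mulz_le_sqrD m (2 * A%:Z - a); have H2 := mulz_le_sqrD m (- (2 * A%:Z + a)).
    have H3 := mulz_le_sqrD (m + r%:Z) A%:Z; have H4 := mulz_le_sqrD (m + r%:Z) (- A%:Z).
    have H5 := mulz_le_sqrD s%:Z A%:Z.
    have P1 : 0 <= (2 * A%:Z - a) * (2 * A%:Z - a) by rewrite -expr2 sqr_ge0.
    have P2 : 0 <= (2 * A%:Z + a) * (2 * A%:Z + a) by rewrite -expr2 sqr_ge0.
    have P3 : 0 <= A%:Z * r%:Z by [].
    case: m H1 H2 H3 H4 => m H1 H2 H3 H4.
      have P4 : 0 <= A%:Z * m%:Z by [].
      by rewrite absz_nat; lia.
    by rewrite /= !NegzE in H1 H2 H3 H4 *; lia.
apply: abs_summable_ext (abs_summable_outer sf) => -[r s].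
rewrite /rs_term /= [RHS]mulrAC /theta -tsum_scale; last exact: abs_summable_theta.
apply: tsum_ext => m; rewrite /g /=.
have -> : h ^ E (r, s, m) = h ^ (r%:Z * r%:Z + s%:Z * s%:Z + r%:Z + s%:Z) *
    h ^ (2 * (m * m) + (a + 2 * r%:Z) * m).
  by rewrite -expfzDr //; congr (h ^ _); rewrite /E /=; clear; lia.
ring.
Qed.

(** Up to terms free of l the exponent is (l^2 - l) + (2 - 2k - b) l: Euler's series, whose value is
    then reflected to make the dependence on k finite. *)
Lemma tadpole_l a b (k i j : nat) :
  tsum (fun l => tadpole a b ((k, (i, j)), l)) =
  qpoch_inf (- h ^ (2 - b)) q * (h ^ (k%:Z * k%:Z + k%:Z) * qpoch (- h ^ b) q k /
    qpoch q q k) * ij_term k a (i, j).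
Proof.
have := abs_summable_eu q0 q1 (h ^ (2 - 2 * k%:Z - b)).
set c := h ^ (2 * (k%:Z * k%:Z) + b * k%:Z) / qpoch q q k * ij_term k a (i, j).
move=> /(tsum_scale c); rewrite -/(euler_sum _ _) -(euler q0 q1) (qpoch_inf_reflect h0 h1).
move=> H; rewrite -[RHS](_ : tsum (fun l => c * (q ^+ 'C(l, 2) * ((h ^ (2 - 2 * k%:Z - b)) ^+ l
    / qpoch q q l))) = _).
  apply: tsum_ext => l.
  rewrite /c /tadpole /ij_term /= q_bin2 exprnP exprz_exp.
  set e1 := (X in h ^ X / _ = _); set e2 := (X in _ = h ^ X / _ * _ * _).
  set e3 := (X in _ = _ * (h ^ X / _) * _); set e4 := (X in _ = _ * (h ^ X * _)).
  set e5 := (X in _ = _ * (_ * (h ^ X / _))).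
  have -> : h ^ e1 = h ^ e2 * h ^ e3 * h ^ e4 * h ^ e5.
    rewrite -!expfzDr //; congr (h ^ _); rewrite /e1 /e2 /e3 /e4 /e5; clear; lia.
  by field; rewrite !qn0.
rewrite H /c.
have -> : h ^ (k%:Z * k%:Z + k%:Z) = h ^ (2 * (k%:Z * k%:Z) + b * k%:Z) *
  h ^ (- (b * k%:Z) - k%:Z * k%:Z + k%:Z).
  by rewrite -expfzDr //; congr (h ^ _); clear; lia.
by field; rewrite qn0.
Qed.

Definition r_term (a b : int) (r : nat) : C :=
  theta (a + 2 * r%:Z) * h ^ (r%:Z * r%:Z + r%:Z) * qpoch (- h ^ b) q r *
  qpoch_inf (- h ^ (b + 2 * r%:Z + 2)) (q ^+ 2) / qpoch q q r.

(** Since (-h^b)_(r+s) = (-h^b)_r (-h^(b+2r))_s, this is Lebesgue's identity at y = h^(b + 2r). *)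
Lemma rs_s a b r : tsum (fun s => rs_term a b (r, s)) = qpoch_inf (- q) q * r_term a b r.
Proof.
have := lebesgue q0 q1 (h ^ (b + 2 * r%:Z)).
rewrite (expzq h0) => H.
pose c := theta (a + 2 * r%:Z) * h ^ (r%:Z * r%:Z + r%:Z) * qpoch (- h ^ b) q r / qpoch q q r.
transitivity (c * (qpoch_inf (- h ^ (b + 2 * r%:Z + 2)) (q ^+ 2) * qpoch_inf (- q) q)); last
    first.
  rewrite /c /r_term; move: (qpoch_inf _ _) (qpoch_inf _ _) (theta _) (qpoch _ _ _) => u v w x.
  by field; rewrite qn0.
rewrite -H -tsum_scale.
  apply: tsum_ext => s; rewrite /rs_term /c /= q_bin2 q_expz // qpochD mulNr.
  rewrite q_expz // -(expfzDr b) //.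
  set e1 := (X in h ^ X * _ * _ / _ = _); set e2 := (X in _ = _ * h ^ X * _ / _ * _).
  set e3 := (X in _ = _ * (h ^ X * _)); set e4 := (X in _ = _ * (_ * (h ^ X * _ / _))).
  have -> : h ^ e1 = h ^ e2 * h ^ e3 * h ^ e4.
    rewrite -!expfzDr //; congr (h ^ _); rewrite /e1 /e2 /e3 /e4; clear; lia.
  by field; rewrite !qn0.
apply: abs_summable_bin2 => //; do !apply: exp_boundedM; [exact: exp_bounded_exp| apply:
    exp_bounded_qpoch; exact: ltW | exact: exp_bounded_qq].
Qed.

Lemma tadpole_reduction a b :
  tsum (tadpole a b) = qpoch_inf (- h ^ (2 - b)) q * qpoch_inf (- q) q / qpoch_inf q q
     * tsum (r_term a b) /\ abs_summable (r_term a b).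
Proof.
have st := abs_summable_tadpole h0 h1 a b; have srs := abs_summable_rs a b.
have nq : qpoch_inf (- q) q != 0 by apply: qpoch_inf_neq0 => //; rewrite normcN.
have sr : abs_summable (r_term a b).
  apply: abs_summable_ext (abs_summable_scale (qpoch_inf (- q) q)^-1 (abs_summable_outer srs))
      => r.
  by rewrite rs_s mulKf.
split=> //; rewrite (fubini st).
have st2 := abs_summable_outer st; rewrite (fubini st2).
have [E sE] := tsum_regroup srs.
have -> : qpoch_inf (- h ^ (2 - b)) q * qpoch_inf (- q) q / qpoch_inf q q * tsum (r_term a b)
  = qpoch_inf (- h ^ (2 - b)) q / qpoch_inf q q * tsum (rs_term a b).
  rewrite (fubini srs) (tsum_ext (rs_s a b)) tsum_scale //; ring.
rewrite E -tsum_scale //; apply: tsum_ext => k.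
pose c := qpoch_inf (- h ^ (2 - b)) q * (h ^ (k%:Z * k%:Z + k%:Z) * qpoch (- h ^ b) q k /
    qpoch q q k).
transitivity (c * tsum (ij_term k a)).
  rewrite -tsum_scale; last exact: abs_summable_ij_term.
  by apply: tsum_ext => -[i j]; rewrite tadpole_l.
apply: (mulIf qi0); rewrite -[LHS]mulrA tsum_ij_term // [RHS]mulrAC.
rewrite divfK // /c !mulr_sumr; apply: eq_bigr => r _.
have rk : (r <= k)%N by rewrite -ltnS.
rewrite /rs_term /= subnKC //.
set e1 := (X in _ * (h ^ X * _ / _) * _ = _); set e2 := (X in h ^ X * _ / (qpoch q q r * _)).
set e3 := (X in _ = _ * (h ^ X * _ * _ / _)).
have -> : h ^ e3 = h ^ e1 * h ^ e2.
  rewrite -!expfzDr //; congr (h ^ _); rewrite /e1 /e2 /e3 -subzn //; clear; lia.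
by field; rewrite !qn0.
Qed.

End Reduction.

(** * The case b = a - 2 *)

Section Summable.
Variable R : realType.
Local Notation C := R[i].
Variable h : C.
Hypothesis h0 : h != 0.
Hypothesis h1 : normc h < 1.
Local Notation q := (h ^+ 2).
Local Notation Q := (q ^+ 2).
Local Notation theta := (theta h).

Let q0 : q != 0. Proof. exact: sq_neq0. Qed.
Let q1 : normc q < 1. Proof. exact: sq_lt1. Qed.
Let Q0 : Q != 0. Proof. exact: sq_neq0. Qed.
Let Q1 : normc Q < 1. Proof. exact: sq_lt1. Qed.
Let Qn0 := qq_neq0 Q1.

Lemma tsum_even_odd (f : nat -> C) : abs_summable f ->
  tsum f = tsum (fun t => f t.*2) + tsum (fun t => f t.*2.+1).
Proof.
move=> sf; pose phi (p : bool * nat) := (p.1 + p.2.*2)%N.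
have bphi : bijective phi.
  exists (fun n => (odd n, n./2)) => [[b t]|n]; rewrite /phi /=.
    by rewrite oddD odd_double half_bit_double; case: b.
  exact: odd_double_half.
rewrite (tsum_bij bphi sf) (fubini ((abs_summable_bij _ bphi).2 sf)).
by rewrite (tsumE (tsum_fin _).1) big_bool /= addrC.
Qed.

Lemma expzQ (x : int) : h ^ x * Q = h ^ (x + 4).
Proof. by rewrite expfzDr // -[h ^ 4]exprnP -exprM. Qed.

Lemma Q_expz (n : nat) : Q ^+ n = h ^ (4 * n%:Z).
Proof. by rewrite -!exprM exprnP; congr (h ^ _); clear; lia. Qed.

Lemma Q_bin2 (n : nat) : Q ^+ 'C(n, 2) = h ^ (2 * (n%:Z * n%:Z) - 2 * n%:Z).
Proof. by rewrite Q_expz //; congr (h ^ _); have := bin2_sqr n; clear; lia. Qed.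

(** For r = 2t, theta(a + 4t) is a power of h times theta(a), and (q)_(2t) = (q; q^2)_t (q^2; q^2)_t
    gives the lower parameter q. It equals h^b h^(4-a) precisely because b = a - 2. *)
Lemma r_term_even a t : r_term h a (a - 2) t.*2 =
  theta a * qpoch_inf (- h ^ a) Q *
  (Q ^+ 'C(t, 2) * (h ^ (4 - a)) ^+ t * qpoch (- h ^ (a - 2)) Q t /
    (qpoch Q Q t * qpoch (h ^ (a - 2) * h ^ (4 - a)) Q t)).
Proof.
have E : h ^ (a - 2) * h ^ (4 - a) = q by rewrite -expfzDr // exprnP; congr (h ^ _); clear; lia.
have q1' : normc Q <= 1 by exact: ltW.
have hq := qpoch_neq0 t q1 q1'.
rewrite E /r_term !qpoch_double mulNr expzq // subrK -expr2.
rewrite (qpoch_inf_split Q0 Q1 (- h ^ a) t) mulNr Q_expz -(expfzDr a) //.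
have -> : a + 2 * t.*2%:Z = a + 4 * t%:Z by clear; lia.
have -> : a - 2 + 2 * t.*2%:Z + 2 = a + 4 * t%:Z by clear; lia.
rewrite thetaD4n // Q_bin2 exprnP exprz_exp.
set e1 := (X in h ^ X * theta a); set e2 := (X in _ * _ * h ^ X * _ * _ / _ = _).
set e3 := (X in _ = _ * (h ^ X * _ * _ / _)); set e4 := (X in _ = _ * (_ * h ^ X * _ / _)).
have -> : h ^ e2 = h ^ e3 * h ^ e4 / h ^ e1.
  rewrite invr_expz -!expfzDr //; congr (h ^ _); rewrite /e1 /e2 /e3 /e4; clear; lia.
by field; rewrite Qn0 hq expfz_neq0.
Qed.

(** As in the even case, now with theta(a + 2) and the lower parameter q^3, from (q)_(2t+1) = (1 -
    q) (q^2; q^2)_t (q^3; q^2)_t. *)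
Lemma r_term_odd a t : r_term h a (a - 2) t.*2.+1 =
  theta (a + 2) * qpoch_inf (- h ^ (a - 2)) Q * q / (1 - q) *
  (Q ^+ 'C(t, 2) * (h ^ (6 - a)) ^+ t * qpoch (- h ^ a) Q t /
    (qpoch Q Q t * qpoch (h ^ a * h ^ (6 - a)) Q t)).
Proof.
have E : h ^ a * h ^ (6 - a) = q * q * q by rewrite -expfzDr // -!exprD exprnP; congr (h ^ _);
    clear; lia.
have q1' : normc Q <= 1 by exact: ltW.
have q31 : normc (q * q * q) < 1 by rewrite -!exprD normcX exprn_ilt1 ?normc_ge0.
have hq := qpoch_neq0 t q31 q1'.
have h1q : 1 - q != 0 by have := onesub_neq0 q1 0; rewrite expr1.
rewrite E /r_term !qpochSl !qpoch_double !mulNr !expzq // subrK -expr2.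
rewrite (qpoch_inf_split Q0 Q1 (- h ^ (a - 2)) 1) qpochSr qpoch0 expr0 mulr1 mul1r expr1 mulNr
    expzQ.
have -> : a - 2 + 4 = a + 2 by clear; lia.
rewrite (qpoch_inf_split Q0 Q1 (- h ^ (a + 2)) t) mulNr Q_expz -(expfzDr (a + 2)) //.
have -> : a + 2 * t.*2.+1%:Z = a + 2 + 4 * t%:Z by clear; lia.
have -> : a - 2 + 2 * t.*2.+1%:Z + 2 = a + 2 + 4 * t%:Z by clear; lia.
rewrite thetaD4n // Q_bin2 exprnP exprz_exp.
set e1 := (X in h ^ X * theta _); set e2 := (X in _ * _ * h ^ X * _ * _ / _ = _).
set e3 := (X in _ = _ * (h ^ X * _ * _ / _)); set e4 := (X in _ = _ * (_ * h ^ X * _ / _)).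
have -> : h ^ e2 = h ^ e3 * h ^ e4 / h ^ e1 * q.
  rewrite invr_expz -!expfzDr // expzq //; congr (h ^ _); rewrite /e1 /e2 /e3 /e4; clear; lia.
by field; rewrite Qn0 hq h1q expfz_neq0.
Qed.

(** After Jacobi's product is inserted for theta(a) and theta(a + 2), peeling off single factors
    brings both halves to the same products. They turn out equal, which gives the factor 2. *)
Lemma tsum_r_term a :
  tsum (r_term h a (a - 2)) = 2 * qpoch_inf Q Q / qpoch_inf q Q *
    (qpoch_inf (- h ^ a) q * qpoch_inf (- h ^ (2 - a)) q).
Proof.
have [_ sr] := tadpole_reduction h0 h1 a (a - 2).
have c1 := qpoch_inf_neq0 Q0 Q1 q1.
have q31 : normc (q * q * q) < 1 by rewrite -!exprD normcX exprn_ilt1 ?normc_ge0.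
have c2 := qpoch_inf_neq0 Q0 Q1 q31.
have h1q : 1 - q != 0 by have := onesub_neq0 q1 0; rewrite expr1.
have one x : qpoch_inf (- h ^ x) Q = (1 + h ^ x) * qpoch_inf (- h ^ (x + 4)) Q.
  by rewrite (qpoch_inf_split Q0 Q1 _ 1) qpochSr qpoch0 expr0 mulr1 mul1r opprK expr1 mulNr expzQ.
have s1 c b y : normc (b * y) < 1 -> abs_summable (fun t => c * (Q ^+ 'C(t, 2) * y ^+ t * qpoch
    (- b) Q t /
    (qpoch Q Q t * qpoch (b * y) Q t))).
  move=> by1; apply: abs_summable_scale.
  apply: abs_summable_ext (abs_summable_bin2 Q0 Q1 (g := fun t => y ^+ t * qpoch (- b) Q t *
      ((qpoch Q Q t)^-1 * (qpoch (b * y) Q t)^-1)) _) => [t|].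
    by rewrite -invfM; ring.
  have Q1' : normc Q <= 1 by exact: ltW.
  by do !apply: exp_boundedM; [exact: exp_bounded_exp|exact: exp_bounded_qpoch|exact:
      exp_bounded_qq|exact: exp_bounded_qpochV].
have e1 : h ^ (a - 2) * h ^ (4 - a) = q by rewrite -expfzDr // exprnP; congr (h ^ _); clear; lia.
have e2 : h ^ a * h ^ (6 - a) = q * q * q by rewrite -expfzDr // -!exprD exprnP; congr (h ^ _);
    clear; lia.
have E1 := phi11_sum Q0 Q1 (b := h ^ (a - 2)) (y := h ^ (4 - a)) ltac:(by rewrite e1).
have E2 := phi11_sum Q0 Q1 (b := h ^ a) (y := h ^ (6 - a)) ltac:(by rewrite e2).
rewrite (tsum_even_odd sr) (tsum_ext (r_term_even a)) (tsum_ext (r_term_odd a)).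
rewrite !tsum_scale ?E1 ?E2; last 2 first.
- by have := s1 1 (h ^ a) (h ^ (6 - a)); rewrite e2 => /(_ q31); apply: abs_summable_ext => t;
    rewrite mul1r.
- by have := s1 1 (h ^ (a - 2)) (h ^ (4 - a)); rewrite e1 => /(_ q1); apply: abs_summable_ext
    => t; rewrite mul1r.
rewrite e1 e2 !(theta_jtp h0 h1 _).1 (qpoch_inf_double q0 q1 (- h ^ a)) (qpoch_inf_double q0 q1
    (- h ^ (2 - a))).
rewrite !mulNr !(expzq h0).
have -> : 2 - (a + 2) = - a by clear; lia.
have -> : a + 2 + 2 = a + 4 by clear; lia.
have -> : 2 - a + 2 = 4 - a by clear; lia.
rewrite (one a) (one (2 - a)) (one (a - 2)) (one (- a)).
have -> : 2 - a + 4 = 6 - a by clear; lia.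
have -> : a - 2 + 4 = a + 2 by clear; lia.
have -> : - a + 4 = 4 - a by clear; lia.
have -> : qpoch_inf q Q = (1 - q) * qpoch_inf (q * q * q) Q.
  have e3 : q * Q = q * q * q by move: q => z; rewrite [z ^+ 2]expr2 mulrA.
  by rewrite (qpoch_inf_split Q0 Q1 q 1) qpochSr qpoch0 expr0 mulr1 mul1r expr1 e3.
have -> : h ^ (2 - a) = q / h ^ a by rewrite expfzDr // invr_expz.
have -> : h ^ (a - 2) = h ^ a / q by rewrite expfzDr.
rewrite -invr_expz.
have ha : h ^ a != 0 by rewrite expfz_neq0.
move: (h ^ a) ha q0 => A A0 q0'.
by field; rewrite A0 h0 h1q c2.
Qed.

End Summable.

(** * The case a = b = 2 *)

Section Cubic.
Variable R : realType.
Local Notation C := R[i].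
Variable h : C.
Hypothesis h0 : h != 0.
Hypothesis h1 : normc h < 1.
Local Notation q := (h ^+ 2).
Local Notation Q := (q ^+ 2).
Local Notation theta := (theta h).

Let q0 : q != 0. Proof. exact: sq_neq0. Qed.
Let q1 : normc q < 1. Proof. exact: sq_lt1. Qed.
Let Q0 : Q != 0. Proof. exact: sq_neq0. Qed.
Let Q1 : normc Q < 1. Proof. exact: sq_lt1. Qed.
Let qn0 := qq_neq0 q1.
Let Qn0 := qq_neq0 Q1.
Let qi0 := qpoch_inf_neq0 q0 q1 q1.

(** The Pascal rule in base q^2 yields two parts. Exchanging k and N - k turns one into the sum for
    N, as n^2 + n is invariant under n -> -1 - n; the other is q^(N+1) times that sum. Then 1 -
    q^(2N+2) = (1 - q^(N+1)) (1 + q^(N+1)). *)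
Lemma gauss_sum N :
  \sum_(k < N.+1) h ^ (((N - k)%N%:Z - k%:Z) * ((N - k)%N%:Z - k%:Z) + ((N - k)%N%:Z - k%:Z)) /
    (qpoch Q Q k * qpoch Q Q (N - k)) = (qpoch q q N)^-1.
Proof.
pose u (k l : nat) : C := h ^ ((l%:Z - k%:Z) * (l%:Z - k%:Z) + (l%:Z - k%:Z)).
elim: N => [|N IH].
  by rewrite big_ord1 /= !qpoch0 [X in h ^ X](_ : _ = 0) ?expr0z ?mulr1 ?mul1r ?invr1 // mulr1.
have E := pascal Q1 u N.
have hN := onesub_neq0 Q1 N; have hq := onesub_neq0 q1 N.
have hQ : 1 - Q ^+ N.+1 = (1 - q ^+ N.+1) * (1 + q ^+ N.+1).
  by rewrite [Q ^+ N.+1]exprAC; move: (q ^+ N.+1) => z; ring.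
apply: (mulIf hN); rewrite E.
have -> : \sum_(t < N.+1) (u t.+1 (N - t)%N + Q ^+ t * u t (N - t).+1) /
     (qpoch Q Q t * qpoch Q Q (N - t)) = (qpoch q q N)^-1 * (1 + q ^+ N.+1).
  under eq_bigr => t _ do rewrite mulrDl.
  rewrite big_split mulrDr mulr1 /= -IH; congr (_ + _).
    rewrite (reindex_inj rev_ord_inj) /=; apply: eq_bigr => t _.
    have tN : (t <= N)%N by rewrite -ltnS.
    rewrite subSS subKn // /u; rewrite [qpoch Q Q t * _]mulrC.
    by congr (h ^ _ / _); clear; lia.
  rewrite mulr_suml; apply: eq_bigr => t _; rewrite [RHS]mulrAC /u.
  congr (_ / _); rewrite Q_expz // q_expz // -!expfzDr //; congr (h ^ _).
  have tN : (t <= N)%N by rewrite -ltnS.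
  have -> : N.+1%:Z = t%:Z + (N - t)%N%:Z + 1 by clear -tN; lia.
  have -> : (N - t).+1%:Z = (N - t)%N%:Z + 1 by clear; lia.
  by move: (Posz (N - t)) => n; clear; lia.
rewrite hQ qpochSr -exprS; field; by rewrite qn0 hq.
Qed.

Definition kl_weight (N : nat) : C := qpoch (- q) q N * qpoch_inf (- h ^ (2 * N%:Z + 4)) Q.

(** With r = k + l the exponent is r^2 + r + (l - k)^2 + (l - k). *)
Definition kl_term (p : nat * nat) : C :=
  h ^ (2 * (p.1%:Z * p.1%:Z) + 2 * (p.2%:Z * p.2%:Z) + 2 * p.2%:Z) *
  theta (2 + 2 * (p.1 + p.2)%N%:Z) * kl_weight (p.1 + p.2) /
  (qpoch Q Q p.1 * qpoch Q Q p.2).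

Lemma kl_regroup N : \sum_(k < N.+1) kl_term (val k, N - k)%N = r_term h 2 2 N.
Proof.
rewrite /r_term -[h ^ 2]exprnP.
transitivity (theta (2 + 2 * N%:Z) * h ^ (N%:Z * N%:Z + N%:Z) * kl_weight N * (qpoch q q
    N)^-1); last first.
  rewrite /kl_weight.
  have -> : 2 + 2 * N%:Z + 2 = 2 * N%:Z + 4 by clear; lia.
  by ring.
rewrite -gauss_sum mulr_sumr; apply: eq_bigr => k _.
have kN : (k <= N)%N by rewrite -ltnS.
rewrite /kl_term /= subnKC //.
set e1 := (X in h ^ X * _ * _ / _ = _); set e2 := (X in _ = _ * h ^ X * _ * _).
set e3 := (X in _ = _ * (h ^ X / _)).
have -> : h ^ e1 = h ^ e2 * h ^ e3.
  by rewrite -expfzDr //; congr (h ^ _); rewrite /e1 /e2 /e3 -subzn //; clear; lia.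
by field; rewrite !Qn0.
Qed.

(** Euler's series at c q^n is dominated term by term by the one at c, so the bound is uniform in
    n. *)
Lemma exp_bounded_qinf (c : C) : exp_bounded id (fun n => qpoch_inf (- (c * q ^+ n)) Q).
Proof.
have [M hM] := abs_summable_eu Q0 Q1 c.
exists `|M|, 1; split=> // n; rewrite expr1n mulr1 (euler Q0 Q1).
apply: le_trans (ler_norm M); apply: tsum_le => B uB; apply: le_trans (hM B uB).
apply: ler_sum => k _; rewrite [(c * _) ^+ k]exprMn !normcM.
rewrite ler_wpM2l ?normc_ge0 // ler_wpM2r ?normc_ge0 // ler_piMr ?normc_ge0 //.
by rewrite !normcX -!exprM exprn_ile1 ?normc_ge0 // ltW.
Qed.

Lemma exp_bounded_W : exp_bounded id kl_weight.
Proof.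
apply: exp_boundedM; first by apply: exp_bounded_qpoch; exact: ltW.
rewrite (_ : (fun _ => _) = (fun n => qpoch_inf (- (h ^ 4 * q ^+ n)) Q)); first exact:
    exp_bounded_qinf.
by apply/funext => n; rewrite [q ^+ n]q_expz -(expfzDr 4) // addrC.
Qed.

(** Theta is expanded again; the exponent becomes (k + m)^2 + (l + m)^2 + k^2 + l^2 + 2 (l + m). *)
Lemma abs_summable_kl : abs_summable kl_term.
Proof.
pose g (p : nat * nat * int) := kl_weight (p.1.1 + p.1.2) *
  ((qpoch Q Q p.1.1)^-1 * (qpoch Q Q p.1.2)^-1).
pose E (p : nat * nat * int) := let k := p.1.1%:Z in let l := p.1.2%:Z in
  2 * (k * k) + 2 * (l * l) + 2 * l + (2 * (p.2 * p.2) + (2 + 2 * (p.1.1 + p.1.2)%N%:Z) * p.2).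
have sf : abs_summable (fun p => h ^ E p * g p).
  apply: (@abs_summable_quad _ h h0 h1 _ (fun p => p.1.1 + p.1.2 + `|p.2|)%N E g).
  - exact: (size_summable_mul (size_summable_mul (size_summable_nat h1) (size_summable_nat h1))
      (size_summable_int h1)).
  - apply: exp_boundedM.
      apply: (exp_bounded_nat (phi := fun p : nat * nat * int => (p.1.1 + p.1.2)%N) (g :=
          kl_weight))
        exp_bounded_W => -[[k l] m] /=; clear; lia.
    apply: exp_boundedM.
      by apply: (exp_bounded_nat (phi := fun p : nat * nat * int => p.1.1)) (exp_bounded_qq Q1)
          => -[[k l] m] /=; clear; lia.
    by apply: (exp_bounded_nat (phi := fun p : nat * nat * int => p.1.2)) (exp_bounded_qq Q1)
        => -[[k l] m] /=; clear; lia.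
  - move=> A; exists ((A%:Z + 1) * (A%:Z + 1) + 1 + (2 * A%:Z + 1) * (2 * A%:Z + 1) + A%:Z *
      A%:Z).
    move=> [[k l] m]; rewrite /E /=.
    have H1 := mulz_le_sqrD (k%:Z + m) A%:Z; have H2 := mulz_le_sqrD (k%:Z + m) (- (A%:Z + 1)).
    have H3 := mulz_le_sqrD (l%:Z + m) (- 1).
    have H4 := mulz_le_sqrD k%:Z 1; have H5 := mulz_le_sqrD k%:Z (2 * A%:Z + 1).
    have H6 := mulz_le_sqrD l%:Z A%:Z.
    have P1 : 0 <= A%:Z * A%:Z by [].
    case: m H1 H2 H3 => m H1 H2 H3; first by rewrite absz_nat; lia.
    by rewrite /= !NegzE in H1 H2 H3 *; lia.
apply: abs_summable_ext (abs_summable_outer sf) => -[k l].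
set c := h ^ (2 * (k%:Z * k%:Z) + 2 * (l%:Z * l%:Z) + 2 * l%:Z) * kl_weight (k + l) /
  (qpoch Q Q k * qpoch Q Q l).
have -> : kl_term (k, l) = c * theta (2 + 2 * (k + l)%N%:Z).
  by rewrite /kl_term /c /=; ring.
rewrite /theta -tsum_scale; last exact: abs_summable_theta.
apply: tsum_ext => m; rewrite /g /=.
have -> : h ^ E (k, l, m) = h ^ (2 * (k%:Z * k%:Z) + 2 * (l%:Z * l%:Z) + 2 * l%:Z) *
    h ^ (2 * (m * m) + (2 + 2 * (k + l)%N%:Z) * m).
  by rewrite -expfzDr.
by rewrite /c invfM; ring.
Qed.

Definition cubic : C := tsum (fun n : int => theta (2 + 2 * n) * h ^ (2 * (n * n) + 2 * n)).

Lemma kl_diffmin (d : int) j : kl_term (diffmin (d, j)) =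
  h ^ (4 * (j%:Z * j%:Z) + 4 * (j%:Z * `|d|%N%:Z) + 2 * (`|d|%N%:Z * `|d|%N%:Z)
       + 2 * j%:Z + 2 * (int_neg d)%:Z) * theta (2 + 2 * `|d|%N%:Z + 4 * j%:Z) *
  kl_weight (`|d| + j.*2) / (qpoch Q Q j * qpoch Q Q (`|d| + j)).
Proof.
rewrite /kl_term /diffmin; case: d => d /=.
  rewrite addn0 [qpoch Q Q (j + d) * _]mulrC (addnC j d) -addnA addnn.
  by congr (h ^ _ * theta _ * _ / _); clear; lia.
rewrite addn0 (addnC j d.+1) addnCA addnn.
by congr (h ^ _ * theta _ * _ / _); clear; lia.
Qed.

(** With e = |d| and z = q^(e+1), the series over the minimum j is the 1phi1 series in base q^2 with
    b = y = z: its lower parameter z^2 = q^(2e+2) comes from (q^2; q^2)_(e+j). *)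
Lemma tsum_kl_fixed_diff (d : int) :
  tsum (fun j => kl_term (diffmin (d, j))) =
  theta (2 - 2 * d) * h ^ (2 * (d * d) - 2 * d) / qpoch_inf q q.
Proof.
pose e := `|d|%N; pose z := h ^ (2 * e%:Z + 2).
have nq1 : normc (- q) < 1 by rewrite normcN.
have nq0 := qpoch_inf_neq0 q0 q1 nq1.
have zz1 : normc (z * z) < 1.
  rewrite /z -expfzDr // (_ : _ + _ = (4 * e + 4)%N%:Z); last by clear; lia.
  by rewrite -exprnP normcX exprn_ilt1 ?normc_ge0 // addn4.
have zzn j : qpoch (z * z) Q j != 0 by apply: qpoch_neq0 => //; exact: ltW.
have zzi := qpoch_inf_neq0 Q0 Q1 zz1.
have E := phi11_sum Q0 Q1 zz1.
have hz : - q * q ^+ e = - z.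
  rewrite mulNr q_expz // -(expfzDr 2) // /z; have -> : 2 + 2 * e%:Z = 2 * e%:Z + 2 by clear; lia.
  by [].
have hQe : Q * Q ^+ e = z * z.
  rewrite Q_expz // mulrC expzQ // /z -expfzDr //.
  by have -> : 4 * e%:Z + 4 = 2 * e%:Z + 2 + (2 * e%:Z + 2) by clear; lia.
have P4 : - z * q = - h ^ (2 * e%:Z + 4).
  by rewrite mulNr /z expzq // -addrA.
have step j : kl_term (diffmin (d, j)) =
   theta (2 + 2 * e%:Z) * h ^ (2 * (e%:Z * e%:Z) + 2 * (int_neg d)%:Z) * qpoch (- q) q e *
     qpoch_inf (- h ^ (2 * e%:Z + 4)) Q / qpoch Q Q e *
   (Q ^+ 'C(j, 2) * z ^+ j * qpoch (- z) Q j / (qpoch Q Q j * qpoch (z * z) Q j)).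
  rewrite kl_diffmin -/e.
  rewrite thetaD4n // /kl_weight !qpochD qpoch_double hz hQe P4.
  have -> : - h ^ (2 * (e + j.*2)%N%:Z + 4) = - h ^ (2 * e%:Z + 4) * Q ^+ j.
    by rewrite mulNr Q_expz // -expfzDr //; congr (- h ^ _); clear; lia.
  rewrite Q_bin2 // [z ^+ j]exprnP /z exprz_exp -/z.
  set e1 := (X in h ^ X * (h ^ _ * _)); set e2 := (X in h ^ _ * (h ^ X * _)).
  set e3 := (X in _ = _ * h ^ X * _ * _ / _ * _); set e4 := (X in _ = _ * (h ^ X * _ * _ / _)).
  set e5 := (X in _ = _ * (_ * h ^ X * _ / _)).
  have -> : h ^ e1 = h ^ e3 * h ^ e4 * h ^ e5 / h ^ e2.
    rewrite invr_expz -!expfzDr //; congr (h ^ _); rewrite /e1 /e2 /e3 /e4 /e5; clear; lia.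
  by rewrite [in RHS](qpoch_inf_split Q0 Q1 (- h ^ (2 * e%:Z + 4)) j); field; rewrite !Qn0 zzn
      expfz_neq0.
have sE : abs_summable (fun t => Q ^+ 'C(t, 2) * z ^+ t * qpoch (- z) Q t / (qpoch Q Q t *
    qpoch (z * z) Q t)).
  apply: abs_summable_ext (abs_summable_bin2 Q0 Q1 (g := fun t => z ^+ t * qpoch (- z) Q t *
      ((qpoch Q Q t)^-1 * (qpoch (z * z) Q t)^-1)) _) => [t|].
    by rewrite -invfM; ring.
  have Q1' : normc Q <= 1 by exact: ltW.
  by do !apply: exp_boundedM; [exact: exp_bounded_exp|exact: exp_bounded_qpoch|exact:
      exp_bounded_qq|exact: exp_bounded_qpochV].
rewrite (tsum_ext step) (tsum_scale _ sE) E.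
(* Both sides are (q^2; q^2)_oo = (q)_oo (-q)_oo, split after e factors; all infinite products then
   cancel except 1/(q)_oo. *)
have Dq : qpoch_inf q q * (qpoch (- q) q e * (qpoch_inf (- z) Q * qpoch_inf (- h ^ (2 * e%:Z +
    4)) Q)) =
    qpoch Q Q e * qpoch_inf (z * z) Q.
  rewrite -hQe -(qpoch_inf_split Q0 Q1 Q e) -(qpoch_inf_sqr q0 q1 q).
  by rewrite (qpoch_inf_split q0 q1 (- q) e) hz (qpoch_inf_double q0 q1 (- z)) P4.
(* For d >= 0, evenness of theta and the shift by 4 relate theta(2 - 2d) to theta(2 + 2d); for d < 0
   the two sides agree literally. This makes the answer uniform in d. *)
have -> : theta (2 - 2 * d) * h ^ (2 * (d * d) - 2 * d) =
    theta (2 + 2 * e%:Z) * h ^ (2 * (e%:Z * e%:Z) + 2 * (int_neg d)%:Z).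
  clear -h0 h1; rewrite /e {e}; case: d => n /=.
    rewrite (_ : 2 + 2 * n%:Z = 2 * n%:Z - 2 + 4); last by clear; lia.
    rewrite thetaD4 // -(thetaN h0 h1 (2 - _)) opprB [RHS]mulrAC [LHS]mulrC -expfzDr //.
    by congr (h ^ _ * _); clear; lia.
  by congr (theta _ * h ^ _); clear; lia.
move: Dq (Qn0 e) zzi qi0; clear.
move: (qpoch_inf q q) (qpoch (- q) q e) (qpoch_inf (- z) Q) (qpoch_inf (- h ^ _) Q).
move: (qpoch Q Q e) (qpoch_inf (z * z) Q) (theta _ * h ^ _) => f g X a b c d' Dq f0 g0 a0.
apply: (mulIf a0); rewrite divfK //.
transitivity (X * (a * (b * (c * d'))) / (f * g)); first by field; rewrite f0 g0.
by rewrite Dq mulfK // mulf_neq0.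
Qed.

Lemma tsum_r_term_cubic : tsum (r_term h 2 2) = cubic / qpoch_inf q q.
Proof.
have sk := abs_summable_kl.
have [E _] := tsum_regroup sk.
rewrite -(tsum_ext kl_regroup) -E (tsum_bij diffmin_bij sk).
have sk' := (abs_summable_bij kl_term diffmin_bij).2 sk.
rewrite (fubini sk') (tsum_ext tsum_kl_fixed_diff).
have s1 : abs_summable (fun d : int => (qpoch_inf q q)^-1 * (theta (2 - 2 * d) * h ^ (2 * (d *
    d) - 2 * d))).
  by apply: abs_summable_ext (abs_summable_outer sk') => d; rewrite tsum_kl_fixed_diff mulrC.
have s2 : abs_summable (fun d : int => theta (2 - 2 * d) * h ^ (2 * (d * d) - 2 * d)).
  by apply: abs_summable_ext (abs_summable_scale (qpoch_inf q q) s1) => d; rewrite mulVKf.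
rewrite (tsum_ext (g := fun d : int => (qpoch_inf q q)^-1 * (theta (2 - 2 * d) * h ^ (2 * (d *
    d) - 2 * d)))); last by move=> d; rewrite mulrC.
rewrite (tsum_scale _ s2) mulrC; congr (_ / _).
rewrite (tsum_bij oppz_bij s2); apply: tsum_ext => d.
by rewrite mulrN opprK mulrNN.
Qed.

Definition cubic_term (p : int * int) : C :=
  h ^ (2 * (p.1 * p.1 + p.1 * p.2 + p.2 * p.2 + p.1 + p.2)).

Lemma abs_summable_cubic_term : abs_summable cubic_term.
Proof.
have sf : abs_summable (fun p : int * int => h ^ (2 * (p.1 * p.1 + p.1 * p.2 + p.2 * p.2 + p.1
    + p.2)) * 1).
  apply: (@abs_summable_quad _ h h0 h1 _ (fun p => `|p.1| + `|p.2|)%N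
    (fun p : int * int => 2 * (p.1 * p.1 + p.1 * p.2 + p.2 * p.2 + p.1 + p.2)) (fun=> 1)).
  - exact: (size_summable_mul (size_summable_int h1) (size_summable_int h1)).
  - exact: exp_bounded_const.
  (* The form 2 (m^2 + m n + n^2) is m^2 + n^2 + (m + n)^2; each variable is bounded with both
     signs, after subtracting its linear term 2m or 2n. *)
  - move=> A; exists (2 * (A%:Z + 2) * (A%:Z + 2)) => -[m n] /=.
    have H1 := mulz_le_sqrD m (A%:Z - 2); have H2 := mulz_le_sqrD m (- (A%:Z + 2)).
    have H3 := mulz_le_sqrD n (A%:Z - 2); have H4 := mulz_le_sqrD n (- (A%:Z + 2)).
    have H5 := sqr_ge0 (m + n); rewrite expr2 in H5.
    case: m n H1 H2 H3 H4 H5 => m [] n H1 H2 H3 H4 H5; rewrite /= ?absz_nat;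
      rewrite ?NegzE in H1 H2 H3 H4 H5 *; lia.
by apply: abs_summable_ext sf => p; rewrite mulr1.
Qed.

Lemma cubicE : cubic = tsum cubic_term.
Proof.
rewrite (fubini abs_summable_cubic_term); apply: tsum_ext => n.
rewrite mulrC /theta -tsum_scale; last exact: abs_summable_theta.
by apply: tsum_ext => m; rewrite -expfzDr // /cubic_term /=; congr (h ^ _); clear; lia.
Qed.

End Cubic.

(** * Product formula for the cubic theta series *)

Section CubicProduct.
Variable R : realType.
Local Notation C := R[i].
Variable h : C.
Hypothesis h0 : h != 0.
Hypothesis h1 : normc h < 1.
Local Notation q := (h ^+ 2).

Let q0 : q != 0. Proof. exact: sq_neq0. Qed.
Let q1 : normc q < 1. Proof. exact: sq_lt1. Qed.
Let qi0 := qpoch_inf_neq0 q0 q1 q1.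

Lemma qpoch_triple (a z : C) n : qpoch a z (3 * n) =
  qpoch a (z ^+ 3) n * qpoch (a * z) (z ^+ 3) n * qpoch (a * z ^+ 2) (z ^+ 3) n.
Proof.
elim: n => [|n IH]; first by rewrite !qpoch0 !mulr1.
rewrite mulnS addnC qpochD IH !qpochSr !qpoch0 expr0 expr1 (exprM z 3 n).
move: ((z ^+ 3) ^+ n) => Z; rewrite mul1r mulr1.
by move: (qpoch _ _ _) (qpoch _ _ _) (qpoch _ _ _) => u v w; ring.
Qed.

Lemma qpoch_inf_triple (a z : C) : z != 0 -> normc z < 1 -> qpoch_inf a z =
  qpoch_inf a (z ^+ 3) * qpoch_inf (a * z) (z ^+ 3) * qpoch_inf (a * z ^+ 2) (z ^+ 3).
Proof.
move=> z0 z1.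
have c0 : z ^+ 3 != 0 by exact: expf_neq0.
have c1 : normc (z ^+ 3) < 1 by rewrite normcX exprn_ilt1 ?normc_ge0.
apply: (seq_lim_unique (u := fun n => qpoch a z (3 * n))).
  move=> e e0; have [N hN] := qpoch_cv z0 z1 a e0.
  by exists N => n Nn; apply: hN; rewrite (leq_trans Nn) // leq_pmull.
rewrite (funext (qpoch_triple a z)).
by apply: seq_lim_mul; [apply: seq_lim_mul|]; exact: qpoch_cv.
Qed.

(* Splits the lattice of (m, n, N) by the class of m - n + N modulo 3; the
   order-3 rotation (m, n) -> (n, -1-m-n) preserves the quadratic form and
   permutes the three classes, each of which is a copy of Z^3. *)
Definition cube_map (p : 'I_3 * (int * (int * int))) : int * int * int :=
  let: (e, (n0, (n1, n2))) := p in
  let m := n1 - n0 in let n := n2 - n1 in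
  ((match val e with 0%N => (m, n) | 1%N => (n, -1 - m - n) | _ => (-1 - m - n, m) end),
   n0 + n1 + n2).

Lemma cube_map_inj : injective cube_map.
Proof.
move=> [[[|[|[|e]]] He] [n0 [n1 n2]]] [[[|[|[|e']]] He'] [n0' [n1' n2']]] //=;
  case=> E1 E2 E3; try (exfalso; clear -E1 E2 E3; lia);
  by congr (_, (_, (_, _))); [apply: val_inj | | |]; rewrite //=; clear -E1 E2 E3; lia.
Qed.

Lemma cube_map_surj p : exists x, cube_map x = p.
Proof.
case: p => [[m n] N].
have [k [r [kr r3]]] : exists k : int, exists r : nat, m - n + N = 3 * k + r%:Z /\ (r < 3)%N.
  exists ((m - n + N) %/ 3)%Z, `|((m - n + N) %% 3)%Z|%N.
  have := divz_eq (m - n + N) 3; have := modz_ge0 (m - n + N) (d := 3) isT.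
  have := ltz_mod (m - n + N) (d := 3) isT.
  by move: ((m - n + N) %/ 3)%Z ((m - n + N) %% 3)%Z => u v; lia.
case: r kr r3 => [|[|[|r]]] kr r3 //.
- by exists (inord 0, (k - m, (k, k + n))); rewrite /= inordK //=; congr (_, _, _); clear -kr;
    lia.
- by exists (inord 1, (k + 1 + n, (k - m, k))); rewrite /= inordK //=; congr (_, _, _); clear
    -kr; lia.
- by exists (inord 2, (k + 1, (k + 1 + n, k - m))); rewrite /= inordK //=; congr (_, _, _);
    clear -kr; lia.
Qed.

(** With m = n1 - n0, n = n2 - n1 and N = n0 + n1 + n2, the form 2 (m^2 + m n + n^2 + m + n) + N^2 -
    N becomes 3 (n0^2 + n1^2 + n2^2) - 3 n0 - n1 + n2. The indices j = 0, 1, 2 supply the three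
    linear coefficients 2j - 3. *)
Definition cubic_theta (j : int) (n : int) : C := h ^ (3 * (n * n) + (2 * j - 3) * n).

Lemma cubic_theta_jtp (j : nat) : (j <= 3)%N -> tsum (cubic_theta j%:Z) = qpoch_inf (q ^+ 3) (q
    ^+ 3) *
    qpoch_inf (- q ^+ j) (q ^+ 3) * qpoch_inf (- q ^+ (3 - j)) (q ^+ 3) /\
  abs_summable (cubic_theta j%:Z).
Proof.
move=> j3.
have g0 : h ^+ 3 != 0 by exact: expf_neq0.
have g1 : normc (h ^+ 3) < 1 by rewrite normcX exprn_ilt1 ?normc_ge0.
have x0 : h ^ (2 * j%:Z - 3) != 0 by rewrite expfz_neq0.
have [H sw] := jtp g0 g1 x0.
have E (m : int) : (h ^+ 3) ^ (m * m) * (h ^ (2 * j%:Z - 3)) ^ m = cubic_theta j%:Z m.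
  by rewrite exprnP !exprz_exp -expfzDr.
split; last exact: abs_summable_ext E sw.
rewrite -(tsum_ext E) H (exprAC h 3 2).
have e1 : h ^ (2 * j%:Z - 3) * h ^+ 3 = q ^+ j.
  by rewrite q_expz [h ^+ 3]exprnP -expfzDr // subrK.
have e2 : h ^+ 3 / h ^ (2 * j%:Z - 3) = q ^+ (3 - j).
  rewrite q_expz invr_expz [h ^+ 3]exprnP -expfzDr //.
  by have -> : 3%:Z + - (2 * j%:Z - 3) = 2 * (3 - j)%N%:Z by clear -j3; lia.
rewrite e1 e2; exact: erefl.
Qed.

Lemma qpoch_inf_N1 (z : C) : z != 0 -> normc z < 1 ->
  qpoch_inf (- 1) z = 2 * qpoch_inf (- z) z.
Proof.
move=> z0 z1; have := qpoch_inf_split z0 z1 (- 1) 1.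
by rewrite qpochSr qpoch0 expr0 mulr1 mul1r opprK expr1 mulN1r -mulr2n.
Qed.

Lemma qpoch_inf_N1_triple (z : C) : z != 0 -> normc z < 1 -> qpoch_inf (- 1) z =
  qpoch_inf (- z ^+ 0) (z ^+ 3) * qpoch_inf (- z ^+ 1) (z ^+ 3) * qpoch_inf (- z ^+ 2) (z ^+ 3).
Proof. by move=> z0 z1; rewrite (qpoch_inf_triple _ z0 z1) !mulN1r. Qed.

Lemma qpoch_inf_N_triple (z : C) : z != 0 -> normc z < 1 -> qpoch_inf (- z) z =
  qpoch_inf (- z ^+ 1) (z ^+ 3) * qpoch_inf (- z ^+ 2) (z ^+ 3) * qpoch_inf (- z ^+ 3) (z ^+ 3).
Proof. by move=> z0 z1; rewrite (qpoch_inf_triple _ z0 z1) !mulNr -exprS. Qed.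

(** Multiply by sum h^(N^2 - N) = (q)_oo (-1)_oo (-q)_oo. Through [cube_map] the product is 3 times
    the product of the three series [cubic_theta]. Jacobi's formula turns these into (q^3; q^3)_oo^3
    times six products in base q^3, which reassemble to (-1)_oo (-q)_oo and cancel. *)
Lemma cubic_product : cubic h = 3 * qpoch_inf (q ^+ 3) (q ^+ 3) ^+ 3 / qpoch_inf q q.
Proof.
have x0 : h ^ (- 1) != 0 by rewrite expfz_neq0.
have [H sw] := jtp h0 h1 x0.
have sc := abs_summable_cubic_term h0 h1.
have sp := abs_summable_mul sc sw.
have P := tsum_mul sc sw.
have [J0 s0] := cubic_theta_jtp (isT : 0 <= 3)%N; have [J1 s1] := cubic_theta_jtp (isT : 1 <=
    3)%N; have [J2 s2] := cubic_theta_jtp (isT : 2 <= 3)%N.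
have s12 := abs_summable_mul s1 s2; have s012 := abs_summable_mul s0 s12.
have E e n0 n1 n2 : (fun p : int * int * int => cubic_term h p.1 * (h ^ (p.2 * p.2) * (h ^ (-
    1)) ^ p.2))
    (cube_map (e, (n0, (n1, n2)))) = cubic_theta 0 n0 * (cubic_theta 1 n1 * cubic_theta 2 n2).
  rewrite /cube_map /cubic_term /cubic_theta exprz_exp -!expfzDr //=; congr (h ^ _).
  by case: e => [[|[|[|e]]] He] //=; clear; lia.
move: P; rewrite (tsum_inj cube_map_inj _ sp); last first.
  by move=> p Hp; have [x xp] := cube_map_surj p; have := Hp x; rewrite xp eqxx.
have sphi := abs_summable_comp cube_map_inj sp.
rewrite (fubini sphi) (tsumE (tsum_fin _).1).
have Ee (e : 'I_3) : tsum (fun j => (fun p : int * int * int => cubic_term h p.1 * (h ^ (p.2 *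
    p.2) * (h ^ (- 1)) ^ p.2))
   (cube_map (e, j))) = tsum (cubic_theta 0) * (tsum (cubic_theta 1) * tsum (cubic_theta 2)).
  rewrite -(tsum_mul s1 s2) -(tsum_mul s0 s12); apply: tsum_ext => -[n0 [n1 n2]]; exact: E.
rewrite (eq_bigr _ (fun e _ => Ee e)) sumr_const card_ord -cubicE // H J0 J1 J2.
have hh : h / h ^ (- 1) = q by rewrite invr_expz.
rewrite hh mulVf // {hh}.
have T1 := qpoch_inf_N1_triple q0 q1; have T2 := qpoch_inf_N_triple q0 q1.
have nq1 : normc (- q) < 1 by rewrite normcN.
have nq := qpoch_inf_neq0 q0 q1 nq1.
have N0 : qpoch_inf (- 1) q != 0.
  by rewrite (qpoch_inf_N1 q0 q1) mulf_neq0 // pnatr_eq0.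
rewrite T1 T2 in N0 nq *.
move: qi0 N0 nq; clear.
rewrite (_ : (3 - 0 = 3)%N) // (_ : (3 - 1 = 2)%N) // (_ : (3 - 2 = 1)%N) //.
move: (qpoch_inf q q) (qpoch_inf (q ^+ 3) _) (qpoch_inf (- q ^+ 0) _)
  (qpoch_inf (- q ^+ 1) _) (qpoch_inf (- q ^+ 2) _) (qpoch_inf (- q ^+ 3) _) (cubic h).
move=> Qi P A0 A1 A2 A3 c Qi0 N0 N1 HH.
apply: (mulIf (mulf_neq0 (mulf_neq0 Qi0 N0) N1)).
rewrite -[LHS]HH.
by field.
Qed.

End CubicProduct.

(** * Product values of the quadruple series *)

Section Values.
Variable R : realType.
Local Notation C := R[i].
Variable h : C.
Hypothesis h0 : h != 0.
Hypothesis h1 : normc h < 1.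
Local Notation q := (h ^+ 2).

Let q0 : q != 0. Proof. exact: sq_neq0. Qed.
Let q1 : normc q < 1. Proof. exact: sq_lt1. Qed.
Let qi0 := qpoch_inf_neq0 q0 q1 q1.

Lemma qpoch_inf_expz_step (x : int) :
  qpoch_inf (- h ^ x) q = (1 + h ^ x) * qpoch_inf (- h ^ (x + 2)) q.
Proof.
have := qpoch_inf_split q0 q1 (- h ^ x) 1.
by rewrite qpochSr qpoch0 expr0 mulr1 mul1r opprK expr1 mulNr expzq.
Qed.

Lemma qpoch_inf_q2 : qpoch_inf (q ^+ 2) (q ^+ 2) = qpoch_inf q q * qpoch_inf (- q) q.
Proof. exact/esym/qpoch_inf_sqr. Qed.

Lemma tadpole_value a : tsum (tadpole h a (a - 2)) = 2 * qpoch_inf (- q) q ^+ 3 *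
  qpoch_inf (- h ^ (4 - a)) q * qpoch_inf (- h ^ a) q * qpoch_inf (- h ^ (2 - a)) q.
Proof.
have [-> _] := tadpole_reduction h0 h1 a (a - 2).
rewrite (tsum_r_term h0 h1).
have -> : 2 - (a - 2) = 4 - a by clear; lia.
have D := qpoch_inf_double q0 q1 q; rewrite -expr2 qpoch_inf_q2 in D.
have nq1 : normc (- q) < 1 by rewrite normcN.
(* Euler's (q; q^2)_oo = 1/(-q)_oo, from the two ways of splitting (q)_oo and (q^2; q^2)_oo. *)
have xP : qpoch_inf q (q ^+ 2) = (qpoch_inf (- q) q)^-1.
  apply: (mulIf (qpoch_inf_neq0 q0 q1 nq1)); rewrite mulVf ?qpoch_inf_neq0 //.
  move: D qi0; move: (qpoch_inf q q) (qpoch_inf q _) (qpoch_inf (- q) q) => A x P D A0.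
  by apply: (mulfI A0); rewrite mulr1 mulrCA -D.
rewrite xP qpoch_inf_q2; move: qi0 (qpoch_inf_neq0 q0 q1 nq1).
move: (qpoch_inf q q) (qpoch_inf (- q) q) => A P A0 P0.
by field; rewrite A0 P0.
Qed.

Lemma tadpole_value1 : tsum (tadpole h 2 2) =
  6 * (qpoch_inf (q ^+ 2) (q ^+ 2) ^+ 2 * qpoch_inf (q ^+ 3) (q ^+ 3) ^+ 3 / qpoch_inf q q ^+ 5).
Proof.
have [-> _] := tadpole_reduction h0 h1 2 2.
rewrite (tsum_r_term_cubic h0 h1) (cubic_product h0 h1) subrr expr0z (qpoch_inf_N1 q0 q1)
    qpoch_inf_q2.
move: qi0; move: (qpoch_inf q q) (qpoch_inf (- q) q) (qpoch_inf _ _) => A P B A0.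
by field.
Qed.

End Values.

(** * Powers of the nome and transfer to the stated form of summation *)

Section Statement.
Variable R : realType.
Local Notation C := R[i].
Implicit Types tau : C.

Lemma cexpD (z w : C) : cexp (z + w) = cexp z * cexp w.
Proof.
case: z w => [a b] [c d]; rewrite /cexp /= expRD cosD sinD.
apply/eqP; rewrite eq_complex /=; apply/andP; split; apply/eqP; ring.
Qed.

Lemma cexp0 : cexp (0 : C) = 1.
Proof.
by rewrite /cexp /= expR0 cos0 sin0 mul1r.
Qed.

Lemma normc_cexp (z : C) : normc (cexp z) = expR (complex.Re z).
Proof.
rewrite /cexp normcM /= expr0n addr0 sqrtr_sqr ger0_norm ?expR_ge0 //.
by rewrite cos2Dsin2 sqrtr1 mulr1.
Qed.

Lemma qpowD tau r s : qpow tau (r + s) = qpow tau r * qpow tau s.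
Proof. by rewrite /qpow rmorphD mulrDr mulrDl cexpD. Qed.

Lemma qpow0 tau : qpow tau 0 = 1.
Proof. by rewrite /qpow rmorph0 mulr0 mul0r cexp0. Qed.

Lemma qpow_neq0 tau r : qpow tau r != 0.
Proof.
apply/eqP => E; have := qpow0 tau; rewrite -(subrr r) qpowD E mul0r => /eqP.
by rewrite eq_sym oner_eq0.
Qed.

Lemma qpow_half tau (n : int) : qpow tau (n%:~R / 2) = qpow tau 2^-1 ^ n.
Proof.
have nat_case (m : nat) : qpow tau (m%:R / 2) = qpow tau 2^-1 ^+ m.
  elim: m => [|m IH]; first by rewrite mul0r qpow0.
  by rewrite -natr1 mulrDl mul1r qpowD IH exprSr.
case: n => n; first exact: nat_case.
rewrite NegzE mulrNz mulNr -exprnN -nat_case.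
apply: (mulIf (qpow_neq0 tau (n.+1%:R / 2))).
by rewrite -qpowD addNr qpow0 mulVf // qpow_neq0.
Qed.

Lemma nomeE tau : nome tau = qpow tau 2^-1 ^+ 2.
Proof.
have := qpow_half tau 2; rewrite -exprnP => <-.
by rewrite /qpow divff // rmorph1 mulr1.
Qed.

Lemma nome_lt1 tau : 0 < complex.Im tau -> normc (nome tau) < 1.
Proof.
move=> t0; rewrite /nome normc_cexp; case: tau t0 => a b /= b0.
rewrite mul0r sub0r -[ltRHS]expR0 ltr_expR oppr_lt0 !mulr_gt0 ?pi_gt0 //.
Qed.

Lemma has_tsum_has_sum4 (f : nat -> nat -> nat -> nat -> C) (s : C) :
  has_tsum (fun p : nat * nat * nat * nat => f p.1.1.1 p.1.1.2 p.1.2 p.2) s -> has_sum4 f s.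
Proof.
pose F (n : nat * nat * nat * nat) := let: (i, j, k, l) := n in f i j k l.
move=> hs; have {}hs : has_tsum F s by apply: has_tsum_ext hs => -[[[i j] k] l].
rewrite /has_sum4; have FF := @totally_filter (nat * nat * nat * nat)%type.
apply/cvgrPdist_lt => -[e e'] /=.
rewrite ltcE /= => /andP[/eqP -> e0]; have [A uA hA] := hs _ e0.
exists [fset x in A]%fset => // B AB /=; rewrite distrC.
have -> : forall z : C^o, `|z| = (normc z)%:C%C by [].
rewrite ltcR.
have -> : partial_sum (F : _ -> C^o) B = \sum_(p <- enum_fset B) F p.
  by rewrite /partial_sum big_seq_fsetE.
apply: (hA (enum_fset B)); first exact: fset_uniq.
by move=> x xA; apply: (fsubsetP AB); rewrite inE.
Qed.

End Statement.

Section Final.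
Variable R : realType.
Local Notation C := R[i].

(** Twice the exponent is an integer, so every power of q in the summand is an integer power of h;
    the indices are only rearranged. *)
Lemma nahm_has_sum (tau : C) (a b : int) (e : rat -> rat -> rat -> rat -> rat) (v : C) :
  0 < complex.Im tau ->
  (forall i j k l, e i j k l = (i * i + (i - j) * (i - j) + (j - k) * (j - k)
     + (k - l) * (k - l) + l + a%:~R * (i - j) + b%:~R * (k - l)) / 2) ->
  tsum (tadpole (qpow tau 2^-1) a b) = v ->
  has_sum4 (nahm_summand tau e) v.
Proof.
move=> t0 eE <-; set h := qpow tau 2^-1.
have h0 : h != 0 by exact: qpow_neq0.
have h1 : normc h < 1.
  by have := nome_lt1 t0; rewrite nomeE normcX expr_lt1 ?normc_ge0.
have st := abs_summable_tadpole h0 h1 a b.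
pose phi (p : nat * nat * nat * nat) := ((p.1.2, (p.1.1.1, p.1.1.2)), p.2).
have bphi : bijective phi.
  by exists (fun p : nat * (nat * nat) * nat => (p.1.2.1, p.1.2.2, p.1.1, p.2)) =>
    [[[[i j] k] l] | [[k [i j]] l]].
apply: has_tsum_has_sum4; rewrite (tsum_bij bphi st).
have := abs_summable_has_tsum ((abs_summable_bij _ bphi).2 st); apply: has_tsum_ext => -[[[i j]
    k] l].
rewrite /nahm_summand /tadpole /phi /= nomeE -/h.
have -> : e i%:R j%:R k%:R l%:R = (i%:Z * i%:Z + (i%:Z - j%:Z) * (i%:Z - j%:Z)
   + (j%:Z - k%:Z) * (j%:Z - k%:Z) + (k%:Z - l%:Z) * (k%:Z - l%:Z) + l%:Z
   + a * (i%:Z - j%:Z) + b * (k%:Z - l%:Z))%:~R / 2.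
  rewrite eE; congr (_ / _).
  by rewrite !(rmorphD, rmorphM, rmorphN).
rewrite qpow_half -/h; congr (_ / _); ring.
Qed.

Lemma J_half (tau : C) (m : rat) (n : nat) : m = n%:R / 2 ->
  J tau m = qpoch_inf (qpow tau 2^-1 ^+ n) (qpow tau 2^-1 ^+ n).
Proof. by move=> ->; rewrite /J -[n%:R]/(n%:Z%:~R) qpow_half. Qed.

End Final.

Theorem theorem1p6 (R : realType) (tau : R[i]) (tau_gt0 : 0 < complex.Im tau) :
  [/\ has_sum4
        (nahm_summand tau (fun i j k l : rat =>
           2^-1 * (i ^+ 2 + (i - j) ^+ 2 + (j - k) ^+ 2 + (k - l) ^+ 2)
           + i - j + k - 2^-1 * l))
        (6 * (J tau 2 ^+ 2 * J tau 3 ^+ 3 / J tau 1 ^+ 5)),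
      has_sum4
        (nahm_summand tau (fun i j k l : rat =>
           2^-1 * (i ^+ 2 + (i - j) ^+ 2 + (j - k) ^+ 2 + (k - l) ^+ 2)
           + 2 * i - 2 * j + k - 2^-1 * l))
        (8 * qpow tau (-1) * (J tau 2 ^+ 6 / J tau 1 ^+ 6)),
      has_sum4
        (nahm_summand tau (fun i j k l : rat =>
           2^-1 * (i ^+ 2 + (i - j) ^+ 2 + (j - k) ^+ 2 + (k - l) ^+ 2)
           + 3 / 2 * i - 3 / 2 * j + 2^-1 * k))
        (2 * qpow tau (- 2^-1) * (J tau 1 ^+ 3 / J tau 2^-1 ^+ 3)) &
      has_sum4
        (nahm_summand tau (fun i j k l : rat =>
           2^-1 * (i ^+ 2 + (i - j) ^+ 2 + (j - k) ^+ 2 + (k - l) ^+ 2)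
           + i - j + 2^-1 * l))
        (4 * (J tau 2 ^+ 6 / J tau 1 ^+ 6))].
Proof.
set h := qpow tau 2^-1.
have h0 : h != 0 by exact: qpow_neq0.
have h1 : normc h < 1.
  by have := nome_lt1 tau_gt0; rewrite nomeE normcX expr_lt1 ?normc_ge0.
have q0 := sq_neq0 h0; have q1 := sq_lt1 h1.
have J1 : J tau 1 = qpoch_inf (h ^+ 2) (h ^+ 2).
  by apply: (@J_half R tau 1 2); field.
have J2 : J tau 2 = qpoch_inf ((h ^+ 2) ^+ 2) ((h ^+ 2) ^+ 2).
  by rewrite -exprM; apply: (@J_half R tau 2 4); field.
have J3 : J tau 3 = qpoch_inf ((h ^+ 2) ^+ 3) ((h ^+ 2) ^+ 3).
  by rewrite -exprM; apply: (@J_half R tau 3 6); field.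
have JH : J tau 2^-1 = qpoch_inf h h.
  by rewrite -[h]expr1; apply: (@J_half R tau 2^-1 1); field.
rewrite J1 J2 J3 JH {J1 J2 J3 JH}.
have -> : qpow tau (-1) = h ^ (- 2) by rewrite -qpow_half; congr qpow.
have -> : qpow tau (- 2^-1) = h ^ (- 1) by rewrite -qpow_half; congr qpow.
have qi0 := qpoch_inf_neq0 q0 q1 q1.
have st0 := qpoch_inf_expz_step h0 h1.
split.
- apply: (nahm_has_sum (a := 2) (b := 2) tau_gt0); last exact: tadpole_value1.
  by move=> i j k l; field.
- apply: (nahm_has_sum (a := 4) (b := 4 - 2) tau_gt0).
    by move=> i j k l; rewrite (_ : 4 - 2 = 2 :> int) //; field.
  rewrite (tadpole_value h0 h1) (qpoch_inf_q2 h0 h1) subrr (_ : 2 - 4 = - 2 :> int) //.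
  (* The products (-q^(-1))_oo, (-1)_oo and (-q^2)_oo are all expressed by (-q)_oo. The quotient (1
     + q^(-1)) / (1 + q) gives q^(-1), and two factors 1 + h^0 raise 2 to 8. *)
  rewrite (st0 (- 2)) addNr (st0 0) add0r expr0z.
  have E2 := st0 2; rewrite -exprnP (_ : 2 + 2 = 4 :> int) // in E2.
  have hm : h ^ (- 2) = (h ^+ 2)^-1 by [].
  rewrite -exprnP hm; move: E2 qi0 q0.
  move: (qpoch_inf (h ^+ 2) _) (qpoch_inf (- h ^+ 2) _) (qpoch_inf (- h ^ 4) _) => A P P4.
  move: (h ^+ 2) => z -> A0 z0.
  by field; rewrite A0 z0.
- apply: (nahm_has_sum (a := 3) (b := 3 - 2) tau_gt0).
    by move=> i j k l; rewrite (_ : 3 - 2 = 1 :> int) //; field.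
  rewrite (tadpole_value h0 h1) (_ : 4 - 3 = 1 :> int) // (_ : 2 - 3 = - 1 :> int) //.
  have E1 := st0 (- 1); rewrite (_ : - 1 + 2 = 1 :> int) // in E1; rewrite E1 {E1}.
  have E1 := st0 1; rewrite (_ : 1 + 2 = 3 :> int) // in E1.
  have hm : h ^ (- 1) = h^-1 by [].
  (* The factors at h^(-1), h and h^3 reduce to h^(-1) (-h; q)_oo^3, and (-h; q)_oo (-q; q)_oo =
     (-h; h)_oo = (q; q)_oo / (h; h)_oo. *)
  rewrite hm; have D1 := qpoch_inf_double h0 h1 (- h); have D2 := qpoch_inf_sqr h0 h1 h.
  rewrite mulNr -expr2 in D1; rewrite D1 in D2.
  rewrite -[h ^ 1]/h in E1 *; rewrite -D2.
  have hi0 := qpoch_inf_neq0 h0 h1 h1.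
  move: E1 hi0 h0.
  move: (qpoch_inf h h) (qpoch_inf (- h ^+ 2) _) (qpoch_inf (- h) _) (qpoch_inf (- h ^ 3) _) =>
      H P P1 P3.
  move: (h) => z -> A0 z0.
  by field; rewrite A0 z0.
- apply: (nahm_has_sum (a := 2) (b := 2 - 2) tau_gt0).
    by move=> i j k l; rewrite (_ : 2 - 2 = 0 :> int) //; field.
  rewrite (tadpole_value h0 h1) (qpoch_inf_q2 h0 h1) subrr (_ : 4 - 2 = 2 :> int) // (st0 0)
      add0r expr0z.
  rewrite -exprnP; move: qi0.
  move: (qpoch_inf (h ^+ 2) _) (qpoch_inf (- h ^+ 2) _) => A P A0.
  by field.
Qed.
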